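(* Let $n\ge1$ and let $r,s,R,\alpha,\gamma\in\mathbf{R}$ with $s>r>0$ and $R>0$. Suppose $b\in CMO$ and that $f$ is a locally bounded measurable function on $\mathbf{R}^n$ with $f\in L^r_{loc}(\mathbf{R}^n,|x|^{n(\alpha-1)})$. Put $$c_1=\Big[2^{n|\alpha|}\,2^{n|\alpha-1|}\,3^{r}\cdot 4\cdot 2^{2nr}\sum_{k=0}^{\infty}2^{-kn|\alpha-1|}k^{r}\Big]^{1/r}.$$ (i) If $\alpha>1$, then $$M_s\big(M_{r,b}(f,\alpha),\gamma\big)(R)\le c_1\,\|b\|_{CMO}\,M_r\big(M_s(f,\gamma),1\big)(R).$$ (ii) If $\alpha<1$, then $$M^*_s\big(M^*_{r,b}(f,\alpha),\gamma\big)(R)\le c_1\,\|b\|_{CMO}\,M^*_r\big(M^*_s(f,\gamma),1\big)(R).$$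
   Context: For $R>0$, $B(R)$ is the ball in $\mathbf{R}^n$ centered at the origin with radius $R$, and $|E|$ denotes the Lebesgue measure of a set $E$. The condition $f\in L^r_{loc}(\mathbf{R}^n,|x|^{n(\alpha-1)})$ means $\int_K|f(x)|^r|x|^{n(\alpha-1)}dx<\infty$ for every compact $K\subset\mathbf{R}^n$. The space $CMO$: for $1\le p<\infty$ and a locally integrable function $b$ on $\mathbf{R}^n$, let $$\|b\|_{CMO^p}=\sup_{B}\left(\frac1{|B|}\int_B|b(x)-b_B|^p\,dx\right)^{1/p},\qquad b_B=\frac1{|B|}\int_B b(x)\,dx,$$ the supremum being over all balls $B\subset\mathbf{R}^n$ centered at the origin. Then $b\in CMO$ means $\|b\|_{CMO}:=\sup_{1\le p<\infty}\|b\|_{CMO^p}<\infty$. Means: for $q>0$, $\beta\in\mathbf{R}$, a measurable function $g$ on $\mathbf{R}^n$ and $\rho>0$, $$M_q(g,\beta)(\rho)=\left[\frac{1}{|B(\rho)|^{\beta}}\int_{B(\rho)}|B(|x|)|^{\beta-1}|g(x)|^q\,dx\right]^{1/q},$$ $$M^*_q(g,\beta)(\rho)=\left[\frac{1}{|B(\rho)|^{\beta}}\int_{\mathbf{R}^n\setminus B(\rho)}|B(|x|)|^{\beta-1}|g(x)|^q\,dx\right]^{1/q}.$$ Commutators: for $y\ne0$, $$M_{r,b}(f,\alpha)(y)=\left[\frac{1}{|B(|y|)|^{\alpha}}\int_{B(|y|)}|B(|x|)|^{\alpha-1}\big(|b(x)-b(y)|\,|f(x)|\big)^r\,dx\right]^{1/r},$$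 $$M^*_{r,b}(f,\alpha)(y)=\left[\frac{1}{|B(|y|)|^{\alpha}}\int_{\mathbf{R}^n\setminus B(|y|)}|B(|x|)|^{\alpha-1}\big(|b(x)-b(y)|\,|f(x)|\big)^r\,dx\right]^{1/r}.$$ In iterated expressions the inner mean is regarded as a function on $\mathbf{R}^n$: in $M_s(M_{r,b}(f,\alpha),\gamma)(R)$ the inner function is $y\mapsto M_{r,b}(f,\alpha)(y)$, in $M_r(M_s(f,\gamma),1)(R)$ it is $y\mapsto M_s(f,\gamma)(|y|)$, and likewise for the starred versions. All quantities take values in $[0,\infty]$ and the inequalities are understood in $[0,\infty]$. *)

(* Defs.v *)
From HB Require Import structures.
From mathcomp Require Import all_boot all_order all_algebra.
From mathcomp Require Import all_classical all_reals all_analysis.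

Set Implicit Arguments.
Unset Strict Implicit.
Unset Printing Implicit Defensive.
Import Order.TTheory GRing.Theory Num.Theory.
Import numFieldNormedType.Exports.

Local Open Scope classical_set_scope.
Local Open Scope ring_scope.

(* Lebesgue measure on R^n is obtained from the outer measure
   inf { sum of the volumes of a countable family of boxes covering A }
   by Caratheodory's construction, so "measurable" means Lebesgue (and not
   only Borel) measurable, and the measure is complete. *)
Section lebesgue_outer_measure.
Context (R : realType) (n : nat).
Implicit Types (c : 'rV[R]_n * 'rV[R]_n) (A : set 'rV[R]_n).

Definition box c : set 'rV[R]_n :=
  [set x | forall i, c.1 0 i < x 0 i <= c.2 0 i].

(* the maximum makes empty boxes have volume 0 *)
Definition box_vol c : \bar R :=
  (\prod_(i < n) Num.max 0 (c.2 0 i - c.1 0 i))%:E.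

Definition box_cover A : set (set ('rV[R]_n * 'rV[R]_n)) :=
  [set C | countable C /\ A `<=` \bigcup_(c in C) box c].

Definition lebesgue_outer A : \bar R :=
  ereal_inf [set \esum_(c in C) box_vol c | C in box_cover A].

Local Open Scope ereal_scope.

Lemma box_vol_ge0 c : 0 <= box_vol c.
Proof.
by rewrite lee_fin; apply: prodr_ge0 => i _; rewrite le_max lexx.
Qed.

Lemma lebesgue_outer_ge0 A : 0 <= lebesgue_outer A.
Proof.
by apply: le_ereal_inf_tmp => _ [C _ <-]; apply: esum_ge0 => c _; exact: box_vol_ge0.
Qed.

Lemma lebesgue_outer0 : lebesgue_outer set0 = 0.
Proof.
apply/eqP; rewrite eq_le lebesgue_outer_ge0 andbT.
by apply: ereal_inf_lbound; exists set0; [split | rewrite esum_set0].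
Qed.

Lemma le_lebesgue_outer : {homo lebesgue_outer : A B / A `<=` B >-> A <= B}.
Proof.
move=> A B AB; apply: ereal_inf_le_tmp => _ [C [cC BC] <-].
by exists C => //; split=> //; exact: subset_trans BC.
Qed.

Lemma lebesgue_outer_sigma_subadditive : sigma_subadditive lebesgue_outer.
Proof.
move=> A; have [[i ioo]|] := pselect (exists i, lebesgue_outer (A i) = +oo).
  rewrite (eseries_pinfty _ _ ioo) ?leey// => k _.
  by rewrite -ltNye (lt_le_trans _ (lebesgue_outer_ge0 _)).
rewrite -forallNE => Aoo.
apply/lee_addgt0Pr => e e0.
rewrite (le_trans _ (epsilon_trick _ _ (ltW e0)))//; last first.
  by move=> k; exact: lebesgue_outer_ge0.
pose P k C := box_cover (A k) C /\
  \esum_(c in C) box_vol c <= lebesgue_outer (A k) + (e / (2 ^ k.+1)%:R)%:E.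
have [G PG] : {G & forall k, P k (G k)}.
  apply: (@choice _ _ P) => k.
  have en1 : (0 < e / (2 ^ k.+1)%:R)%R by rewrite divr_gt0// ltr0n expn_gt0.
  have fA : lebesgue_outer (A k) \is a fin_num.
    by rewrite ge0_fin_numE ?lebesgue_outer_ge0// ltey; apply/eqP/Aoo.
  have [x [C AC <-] xS] := lb_ereal_inf_adherent en1 fA.
  by exists C; split => //; exact: ltW.
apply: (@le_trans _ _ (\esum_(c in \bigcup_k G k) box_vol c)).
  apply: ereal_inf_lbound; exists (\bigcup_k G k) => //; split.
    by apply: bigcup_countable => // k _; have [[]] := PG k.
  move=> x [k _ Akx]; have [[_ /(_ x Akx)[c Gc bc]] _] := PG k.
  by exists c => //; exists k.
rewrite seqDU_bigcup_eq esum_bigcupT; last 2 first.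
- exact: trivIset_seqDU.
- exact: box_vol_ge0.
rewrite -nneseries_esumT; last first.
  by move=> k; apply: esum_ge0 => c _; exact: box_vol_ge0.
apply: lee_nneseries => k _.
  by move=> _; apply: esum_ge0 => c _; exact: box_vol_ge0.
apply: le_trans (PG k).2.
rewrite esum_mkcond [leRHS]esum_mkcond; apply: le_esum => c _.
case: ifPn; rewrite ?inE.
  by move=> /(@subset_seqDU _ G k) Gc; rewrite mem_set.
by move=> _; case: ifP => // _; exact: box_vol_ge0.
Qed.

HB.instance Definition _ := isOuterMeasure.Build R 'rV[R]_n lebesgue_outer
  lebesgue_outer0 lebesgue_outer_ge0 le_lebesgue_outer
  lebesgue_outer_sigma_subadditive.

End lebesgue_outer_measure.

(* R^n with the Lebesgue sigma-algebra; convertible to 'rV[R]_n, whose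
   (product) topology is the one meant in compact and nbhs below *)
Notation euclid R n := (caratheodory_type (@lebesgue_outer R n)).

Definition lebesgue_rV (R : realType) (n : nat) : set (euclid R n) -> \bar R :=
  @lebesgue_outer R n.
HB.instance Definition _ (R : realType) (n : nat) :=
  isMeasure.Build _ (euclid R n) R (@lebesgue_rV R n)
    (@caratheodory_measure0 _ _ (@lebesgue_outer R n))
    (@caratheodory_measure_ge0 _ _ (@lebesgue_outer R n))
    (@caratheodory_measure_sigma_additive _ _ (@lebesgue_outer R n)).

Section means.
Context (R : realType) (n : nat).
Notation E := (euclid R n).
Notation mu := (@lebesgue_rV R n).

(* the norm that the library puts on 'rV[R]_n is the sup norm *)
Definition enorm (x : 'rV[R]_n) : R := Num.sqrt (\sum_(i < n) x 0 i ^+ 2).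

Definition cball (rho : R) : set E := [set x | enorm x < rho].

Definition vol (rho : R) : R := fine (mu (cball rho)).

Definition locally_bounded (f : E -> R) :=
  forall x : 'rV[R]_n, bounded_near f (nbhs x).

Local Open Scope ereal_scope.

Definition locally_integrable_rV (b : E -> R) :=
  measurable_fun [set: E] b /\
  forall K : set 'rV[R]_n, compact K -> \int[mu]_(x in K) `|b x|%:E < +oo.

Definition weighted_Lloc (r w : R) (f : E -> R) :=
  forall K : set 'rV[R]_n, compact K ->
    \int[mu]_(x in K) (`|f x| `^ r * enorm x `^ w)%:E < +oo.

Definition ball_avg (b : E -> R) (rho : R) : R :=
  ((vol rho)^-1 * \int[mu]_(x in cball rho) b x)%R.

Definition CMOp_norm (p : R) (b : E -> R) : \bar R :=
  ereal_sup [set ((vol rho)^-1%:E *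
      \int[mu]_(x in cball rho) (`|b x - ball_avg b rho| `^ p)%:E) `^ p^-1
    | rho in [set rho : R | (0 < rho)%R]].

Definition CMO_norm (b : E -> R) : \bar R :=
  ereal_sup [set CMOp_norm p b | p in [set p : R | (1 <= p)%R]].

Definition CMO (b : E -> R) := locally_integrable_rV b /\ CMO_norm b < +oo.

(* g may be infinite: it is itself a mean in the iterated expressions *)
Definition wmean (D : set E) (q : R) (g : E -> \bar R) (beta rho : R) : \bar R :=
  ((vol rho `^ beta)^-1%:E *
   \int[mu]_(x in D) ((vol (enorm x) `^ (beta - 1))%:E * `|g x| `^ q)) `^ q^-1.

Definition M q g beta rho := wmean (cball rho) q g beta rho.

Definition Mstar q g beta rho := wmean (~` cball rho) q g beta rho.

Definition Mcomm (r : R) (b f : E -> R) (alpha : R) (y : E) : \bar R :=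
  M r (fun x => (`|b x - b y| * `|f x|)%:E) alpha (enorm y).

Definition Mstar_comm (r : R) (b f : E -> R) (alpha : R) (y : E) : \bar R :=
  Mstar r (fun x => (`|b x - b y| * `|f x|)%:E) alpha (enorm y).

End means.

Definition c1 (R : realType) (n : nat) (r alpha : R) : \bar R :=
  ((2 `^ (n%:R * `|alpha|) * 2 `^ (n%:R * `|alpha - 1|) * 3 `^ r * 4
     * 2 `^ (2 * n%:R * r))%:E *
   \sum_(0 <= k <oo) (2 `^ (- (k%:R * n%:R * `|alpha - 1|)) * k%:R `^ r)%:E)%E
  `^ r^-1.

(* Main.v *)
(* A function in CMO is essentially bounded: the supremum over all exponents p
   of its p-th mean oscillations controls the sup norm of b - b_B on every ball
   B centered at 0, by Chebyshev's inequality with p -> oo.  Hence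
   |b x - b y| <= 2 ||b||_CMO for almost all x, y, and it is enough to prove the
   mixed mean inequality without b, with constant 1, since c1 >= 2.

   Put V x = |B(|x|)|.  On the domain of integration of the inner mean,
   V(y)^-alpha V(x)^(alpha-1) <= V(y)^-1, so alpha disappears.  What remains is
   Minkowski's integral inequality for the multiplicative convolution
   y |-> V(y)^-1 int phi(x) k(V x / V y) dx with phi = |f|^r, where k is the
   indicator function of ]0,1[ or of [1,oo[.  As f is not radial, x cannot be
   dilated; instead the inequality is proved by duality, substituting
   u = V x / V y for fixed x.  This only uses that dV/V is invariant under
   dilations and inversion and that V pushes Lebesgue measure to a multiple of
   Lebesgue measure, not polar coordinates.  If the unit ball had measure 0, then
   all integrals would vanish, so the positivity of its volume is not needed. *)
From HB Require Import structures.
Require Import Defs.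
From mathcomp Require Import all_boot all_order all_algebra.
From mathcomp Require Import all_classical all_reals all_analysis.
From mathcomp Require Import measurable_realfun lra ring.

Import Order.TTheory GRing.Theory Num.Theory.
Import numFieldNormedType.Exports.
Local Open Scope classical_set_scope.
Local Open Scope ring_scope.

(** * Minkowski inequality for multiplicative convolutions *)

Lemma measurable_invr (R : realType) :
  measurable_fun [set: R] (@GRing.inv R).
Proof.
have -> : @GRing.inv R =
    fun x => if 0 <= x then x `^ (-1) else - ((- x) `^ (-1)).
  apply/funext => x; case: ifPn => [x0|]; first by rewrite powR_inv1.
  by rewrite -ltNge => x0; rewrite powR_inv1 ?oppr_ge0 ?ltW// invrN opprK.
apply: measurable_fun_ifT; first exact: measurable_fun_ler.
- exact: measurable_powR.
- apply: measurableT_comp => //.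
  by apply: (measurableT_comp (measurable_powR (-1))); exact: oppr_measurable.
Qed.

Lemma measurable_fun_invr d (T : measurableType d) (R : realType) (f : T -> R) :
  measurable_fun [set: T] f -> measurable_fun [set: T] (fun x => (f x)^-1).
Proof. exact: measurableT_comp (measurable_invr R). Qed.

Lemma measurable_fun_powRr d (T : measurableType d) (R : realType) (f : T -> R) a :
  measurable_fun [set: T] f -> measurable_fun [set: T] (fun x => f x `^ a).
Proof. exact: measurableT_comp (measurable_powR a). Qed.

(** Structural measurability: each pass peels off the outermost operation of the integrand;
    conditionals are split by the last rule. *)
Ltac meas := repeat match goal with
  | |- measurable_fun _ (fun x => ?f) => exact: measurable_cst
  | |- measurable_fun _ (fun x => x) => exact: measurable_id
  | |- measurable_fun _ (fun x => x.1) => exact: measurable_fst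
  | |- measurable_fun _ (fun x => x.2) => exact: measurable_snd
  | H : measurable_fun setT ?f |- measurable_fun setT ?f => exact: H
  | H : measurable_fun setT ?f |- measurable_fun setT (fun x => ?f x) => exact: H
  | |- measurable_fun _ (fun x => (@?f x)%:E) => apply/measurable_EFinP
  | |- measurable_fun _ (fun x => (@?f x * @?g x)%R) =>
      apply: (@measurable_funM _ _ _ _ f g)
  | |- measurable_fun _ (fun x => (@?f x * @?g x)%E) =>
      apply: (@emeasurable_funM _ _ _ _ f g)
  | |- measurable_fun _ (fun x => (@?f x - @?g x)%R) =>
      apply: (@measurable_funB _ _ _ _ f g)
  | |- measurable_fun _ (fun x => (@?f x)^-1%R) =>
      apply: (@measurable_fun_invr _ _ _ f)
  | |- measurable_fun _ (fun x => `|@?f x|%R) =>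
      apply: (@measurableT_comp _ _ _ _ _ _ _ _ f (@normr_measurable _ setT))
  | |- measurable_fun _ (fun x => ((@?f x) `^ _)%R) =>
      apply: (@measurable_fun_powRr _ _ _ f)
  | |- measurable_fun _ (fun x => ((@?f x) `^ _)%E) =>
      apply: (@measurableT_comp _ _ _ _ _ _ _ _ f (measurable_poweR _))
  | |- measurable_fun _ (fun x => (@?f x < @?g x)%R) =>
      apply: (@measurable_fun_ltr _ _ _ _ f g)
  | |- measurable_fun _ (fun x => (@?f x <= @?g x)%R) =>
      apply: (@measurable_fun_ler _ _ _ _ f g)
  | |- measurable_fun _ (fun x => (@?b x) && (@?c x)) =>
      apply: (@measurable_and _ _ _ b c)
  | H : measurable_fun setT ?f |- measurable_fun setT (fun x => ?f (@?g x)) =>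
      apply: (@measurableT_comp _ _ _ _ _ _ _ _ g H)
  | |- _ => apply: measurable_fun_ifT
  end.

Lemma measurable_bool d (T : measurableType d) (b : T -> bool) :
  measurable_fun [set: T] b -> measurable [set x | b x].
Proof. by move=> /(_ measurableT [set true] I); rewrite setTI. Qed.

(** * Invariance of dV/V under dilations and inversion *)

Section radial.
Context d (T : measurableType d) (R : realType).
Context (mu : {sigma_finite_measure set T -> \bar R}) (V : T -> R).
Context (mV : measurable_fun [set: T] V).
Context (V0 : forall x, 0 <= V x).
(** The image of [mu] under [V] scales like Lebesgue measure on the half-line, and [unitV] fixes the
    multiplicative constant. In the application [V x] is the volume of the ball of radius
    [enorm x]. *)
Context (dilV : forall (c : R) (G : R -> \bar R), 0 < c ->
  measurable_fun [set: R] G -> (forall t, 0 <= G t)%E ->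
  (\int[mu]_x G (c * V x)%R = c^-1%:E * \int[mu]_x G (V x))%E).
Context (unitV : mu [set x | 0 < V x < 1] = 1%E).

Local Notation "'mfun' f" := (measurable_fun setT f) (at level 10, f at level 9).

Lemma tonelliR (F : T -> T -> R) :
  measurable_fun [set: T * T] (fun z => F z.1 z.2) -> (forall x y, 0 <= F x y) ->
  (\int[mu]_x \int[mu]_y (F x y)%:E = \int[mu]_y \int[mu]_x (F x y)%:E)%E.
Proof.
move=> mF F0.
apply: (@fubini_tonelli _ _ _ _ _ mu mu (fun z => (F z.1 z.2)%:E)) => [|z].
  exact/measurable_EFinP.
by rewrite lee_fin.
Qed.

Lemma integralZE (a : R) (F : T -> R) : 0 <= a -> mfun F -> (forall x, 0 <= F x) ->
  (\int[mu]_x (a * F x)%:E = a%:E * \int[mu]_x (F x)%:E)%E.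
Proof.
move=> a0 mF F0; under eq_integral do rewrite EFinM.
rewrite ge0_integralZl//; first exact/measurable_EFinP.
by move=> x _; rewrite lee_fin.
Qed.

Lemma integralZrE (a : \bar R) (F : T -> R) : (0 <= a)%E -> mfun F -> (forall x, 0 <= F x) ->
  (\int[mu]_x ((F x)%:E * a) = (\int[mu]_x (F x)%:E) * a)%E.
Proof.
move=> a0 mF F0; rewrite ge0_integralZr//; first exact/measurable_EFinP.
by move=> x _; rewrite lee_fin.
Qed.

(** Apply [dilV] to t^-1 G(t): the factor c^-1 contained in (c V)^-1 cancels the Jacobian c^-1. *)
Lemma haar_dilation (c : R) (G : R -> R) : 0 < c -> mfun G -> (forall t, 0 <= G t) ->
  (\int[mu]_x ((V x)^-1 * G (c * V x))%:E = \int[mu]_x ((V x)^-1 * G (V x))%:E)%E.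
Proof.
move=> c0 mG G0.
have mI : mfun (fun t : R => `|t^-1 * G t|%:E) by meas.
(* [dilV] asks for nonnegativity on all of R, but [t^-1 * G t] can be negative for [t < 0]. The
   absolute value disappears again since [V x >= 0]. *)
have := @dilV c _ c0 mI (fun t => normr_ge0 _).
under eq_integral do
  rewrite ger0_norm ?mulr_ge0 ?invr_ge0 ?mulr_ge0 ?(ltW c0)// invfM -mulrA.
under [X in _ = (_ * X)%E -> _]eq_integral do rewrite ger0_norm ?mulr_ge0 ?invr_ge0//.
rewrite integralZE ?invr_ge0 ?(ltW c0)//; last 2 first.
- by meas.
- by move=> x; rewrite mulr_ge0 ?invr_ge0.
move=> /(congr1 (fun z => c%:E * z)%E); rewrite !muleA -!EFinM divff ?gt_eqF//.
by rewrite !mul1e.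
Qed.

(** The value [t] cancels the density [(V x)^-1], so the integral against dV/V is the measure of {0
    < V < 1}, which is 1. *)
Let unit_profile (t : R) : R := if 0 < t < 1 then t else 0.

Let munit_profile : mfun unit_profile.
Proof. by rewrite /unit_profile; meas. Qed.

Let unit_profile0 t : 0 <= unit_profile t.
Proof. by rewrite /unit_profile; case: ifPn => // /andP[/ltW]. Qed.

Let haar_unit_profile : (\int[mu]_x ((V x)^-1 * unit_profile (V x))%:E = 1)%E.
Proof.
have mA : measurable [set x : T | 0 < V x < 1] by apply: measurable_bool; meas.
rewrite -unitV -[in RHS](setIT [set x : T | _]) -integral_indic//.
apply: eq_integral => x _; rewrite indicE /unit_profile; congr EFin.
case: ifPn => h; last by rewrite memNset ?mulr0//; exact/negP.
by rewrite mem_set// mulVf// gt_eqF//; case/andP: h.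
Qed.

(* Write J(K) for the right-hand side.  For a test function g with J(g) = 1,
   dilating one variable at a time turns J(g) J(K o inv) into J(g) J(K), as for
   any Haar measure of an abelian group. *)
Lemma haar_inversion (K : R -> R) : mfun K -> (forall t, 0 <= K t) ->
  (\int[mu]_x ((V x)^-1 * K (V x)^-1)%:E = \int[mu]_x ((V x)^-1 * K (V x))%:E)%E.
Proof.
move=> mK K0; set g := unit_profile.
have mg : mfun g by exact: munit_profile.
have g0 : forall t, 0 <= g t by exact: unit_profile0.
have Vi x : 0 <= (V x)^-1 by rewrite invr_ge0.
transitivity (\int[mu]_x \int[mu]_y ((V x)^-1 * g (V x) * ((V y)^-1 * K (V x * (V y)^-1)))%:E)%E.
  rewrite -[LHS]mul1e -haar_unit_profile -integralZrE//; last 3 first.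
  - by apply: integral_ge0 => x _; rewrite lee_fin mulr_ge0.
  - by meas.
  - by move=> x; rewrite mulr_ge0.
  apply: eq_integral => x _; rewrite integralZE ?mulr_ge0//; last 2 first.
  - by meas.
  - by move=> y; rewrite mulr_ge0.
  (* Where [V x = 0] no dilation by [(V x)^-1] is possible, but the convention [0^-1 = 0] makes both
     sides vanish. *)
  have [->|x0] := eqVneq (V x) 0; first by rewrite invr0 mul0r !mul0e.
  have Vx0 : 0 < (V x)^-1 by rewrite invr_gt0 lt_def x0 V0.
  congr (_ * _)%E; rewrite -(@haar_dilation _ (fun t => K t^-1) Vx0)//; last by meas.
  by apply: eq_integral => y _; rewrite invfM invrK.
rewrite tonelliR; last 2 first.
- by meas.
- by move=> x y; rewrite !mulr_ge0.
transitivity (\int[mu]_y \int[mu]_x ((V y)^-1 * ((V x)^-1 * (g (V y * V x) * K (V x))))%:E)%E.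
  apply: eq_integral => y _.
  transitivity (\int[mu]_x ((V y)^-1 * ((V x)^-1 * (g (V x) * K (V x * (V y)^-1))))%:E)%E.
    by apply: eq_integral => x _; congr EFin; ring.
  have [->|y0] := eqVneq (V y) 0.
    by apply: eq_integral => x _; rewrite invr0 !mul0r.
  have Vy0 : 0 < (V y)^-1 by rewrite invr_gt0 lt_def y0 V0.
  rewrite !integralZE//; last 4 first.
  - by meas.
  - by move=> x; rewrite !mulr_ge0.
  - by meas.
  - by move=> x; rewrite !mulr_ge0.
  congr (_ * _)%E.
  rewrite -(@haar_dilation _ (fun t => g (V y * t) * K t) Vy0)//; last 2 first.
  - by meas.
  - by move=> x; rewrite mulr_ge0.
  by apply: eq_integral => x _; rewrite mulVKf ?(mulrC (V x))// mulKf.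
rewrite -tonelliR; last 2 first.
- by meas.
- by move=> x y; rewrite !mulr_ge0.
apply: eq_integral => x _.
transitivity (\int[mu]_y (((V x)^-1 * K (V x)) * ((V y)^-1 * g (V x * V y)))%:E)%E.
  by apply: eq_integral => y _; congr EFin; rewrite (mulrC (V y) (V x)); ring.
rewrite integralZE; last 3 first.
- by rewrite mulr_ge0.
- by meas.
- by move=> y; rewrite mulr_ge0.
have [->|x0] := eqVneq (V x) 0; first by rewrite invr0 mul0r !mul0e.
rewrite (@haar_dilation _ g)//; last by rewrite lt_def x0 V0.
by rewrite haar_unit_profile mule1.
Qed.

(* Substitution [u = V x / V y] for fixed [x]. *)
Lemma tonelli_quotient (phi : T -> R) (P k : R -> R) :
  mfun phi -> (forall x, 0 <= phi x) -> mfun P -> (forall t, 0 <= P t) ->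
  mfun k -> (forall t, 0 <= k t) -> P 0 = 0 -> k 0 = 0 ->
  (\int[mu]_y \int[mu]_x (P (V y) * ((V y)^-1 * (phi x * k (V x / V y))))%:E =
   \int[mu]_z \int[mu]_x ((V z)^-1 * k (V z) * (phi x * P (V x / V z)))%:E)%E.
Proof.
move=> mphi phi0 mP P0 mk k0 P00 k00.
have Vi x : 0 <= (V x)^-1 by rewrite invr_ge0.
rewrite -tonelliR; last 2 first.
- by meas.
- by move=> x y; rewrite !mulr_ge0.
rewrite -[RHS]tonelliR; last 2 first.
- by meas.
- by move=> x y; rewrite !mulr_ge0.
apply: eq_integral => x _.
transitivity ((phi x)%:E * \int[mu]_y ((V y)^-1 * (P (V y) * k (V x / V y)))%:E)%E.
  rewrite -integralZE//; last 2 first.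
  - by meas.
  - by move=> y; rewrite !mulr_ge0.
  by apply: eq_integral => y _; congr EFin; ring.
transitivity ((phi x)%:E * \int[mu]_y ((V y)^-1 * (P (V x / V y) * k (V y)))%:E)%E; last first.
  rewrite -integralZE//; last 2 first.
  - by meas.
  - by move=> y; rewrite !mulr_ge0.
  by apply: eq_integral => y _; congr EFin; ring.
congr (_ * _)%E.
(* This is where [P 0 = 0] and [k 0 = 0] enter: the substitution breaks down for [V x = 0], and they
   make both sides 0. *)
have [->|x0] := eqVneq (V x) 0.
  by apply: eq_integral => y _; rewrite !mul0r P00 k00 mulr0 mul0r.
have Vx0 : 0 < V x by rewrite lt_def x0 V0.
pose G t := P t * k (V x / t).
have mG : mfun G by rewrite /G; meas.
have G0 t : 0 <= G t by rewrite mulr_ge0.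
(* Inversion followed by dilation by [(V x)^-1] replaces V y by V x / V y, which exchanges the
   arguments of [P] and [k]. *)
rewrite -[LHS]/(\int[mu]_y ((V y)^-1 * G (V y))%:E)%E -haar_inversion//.
rewrite -(@haar_dilation (V x)^-1 (fun t => G t^-1)) ?invr_gt0//; last by meas.
apply: eq_integral => y _; rewrite /G invfM invrK; congr (_ * (_ * k _))%:E.
by rewrite invfM invrK mulrA divff ?gt_eqF// mul1r.
Qed.

(** Hölder with exponents p and p' = (1 - 1/p)^-1 after splitting the weight as g = g^(1/p) g^(1 -
    1/p); note (p - 1) p' = p. *)
Lemma weighted_hoelder (p : R) (phi g h : T -> R) : 1 < p ->
  mfun phi -> mfun g -> mfun h ->
  (forall x, 0 <= phi x) -> (forall x, 0 <= g x) -> (forall x, 0 <= h x) ->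
  (\int[mu]_x (phi x * (g x * h x `^ (p - 1)))%:E <=
   (\int[mu]_x (phi x `^ p * g x)%:E) `^ p^-1 *
   (\int[mu]_x (g x * h x `^ p)%:E) `^ (1 - p^-1))%E.
Proof.
move=> p1 mphi mg mh phi0 g0 h0.
have p0 : 0 < p by exact: lt_trans p1.
have q0 : 0 < 1 - p^-1 by rewrite subr_gt0 invf_lt1.
have := @hoelder _ _ _ mu (fun x => phi x * g x `^ p^-1)
  (fun x => g x `^ (1 - p^-1) * h x `^ (p - 1)) p (1 - p^-1)^-1.
have q0' : 0 < (1 - p^-1)^-1 by rewrite invr_gt0.
have p1E : p^-1 + (1 - p^-1) = 1 by rewrite addrC subrK.
have pq : p^-1 + (1 - p^-1)^-1^-1 = 1 by rewrite invrK.
move=> /(_ ltac:(by meas) ltac:(by meas) p0 q0' pq).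
rewrite Lnorm1 unlock /= invrK.
under eq_integral.
  move=> x _; rewrite ger0_norm ?mulr_ge0 ?powR_ge0//.
  rewrite (_ : _ * _ * _ = phi x * (g x * h x `^ (p - 1))); last first.
    rewrite !mulrA; congr (_ * _); rewrite -mulrA; congr (_ * _).
    by rewrite -powRD p1E ?powRr1 ?oner_eq0.
  over.
under [X in (_ <= X `^ _ * _)%E -> _]eq_integral.
  move=> x _; rewrite ger0_norm ?mulr_ge0 ?powR_ge0// powRM ?powR_ge0//.
  rewrite -powRrM mulVf ?gt_eqF// powRr1//.
  over.
under [X in (_ <= _ * X `^ _)%E -> _]eq_integral.
  move=> x _; rewrite ger0_norm ?mulr_ge0 ?powR_ge0// powRM ?powR_ge0//.
  rewrite -!powRrM mulfV ?gt_eqF// powRr1//.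
  rewrite (_ : (p - 1) / _ = p); last by field; rewrite subr_eq0 !gt_eqF.
  over.
by [].
Qed.

(* only used for [0 <= t]; the absolute value makes it nonnegative on all of R *)
Definition mconv (psi : T -> R) (h : R -> R) (t : R) : \bar R :=
  \int[mu]_x (`|t|^-1 * (psi x * h (V x / t)))%:E.

Lemma measurable_mconv (psi : T -> R) (h : R -> R) : mfun psi -> mfun h ->
  (forall x, 0 <= psi x) -> (forall t, 0 <= h t) -> mfun (mconv psi h).
Proof.
move=> mpsi mh psi0 h0.
apply: (@measurable_fun_fubini_tonelli_F _ _ _ _ _ mu
  (fun z : R * T => (`|z.1|^-1 * (psi z.2 * h (V z.2 / z.1)))%:E)).
  by meas.
by move=> z; rewrite lee_fin !mulr_ge0 ?invr_ge0.
Qed.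

Lemma mconv_ge0 (psi : T -> R) (h : R -> R) t : (forall x, 0 <= psi x) -> (forall t, 0 <= h t) ->
  (0 <= mconv psi h t)%E.
Proof.
by move=> psi0 h0; apply: integral_ge0 => x _; rewrite lee_fin !mulr_ge0 ?invr_ge0.
Qed.

(** * Minkowski's integral inequality for [mconv], by duality and truncation *)

Section minkowski.
Context (p : R) (phi : T -> R) (w k : R -> R).
Context (p_gt1 : 1 < p).
Context (mphi : mfun phi).
Context (mw : mfun w).
Context (mk : mfun k).
Context (phi_ge0 : forall x, 0 <= phi x).
Context (w_ge0 : forall t, 0 <= w t).
Context (k_ge0 : forall t, 0 <= k t).
Context (w0 : w 0 = 0).
Context (k0 : k 0 = 0).

(** The integral over z of [k (V z)] times an L^p norm of [phi]. Since [phi] is not a function of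
    [V], the dilation by V z acts on the weight [w] instead of on [phi]. *)
Let S : \bar R :=
  (\int[mu]_z ((k (V z))%:E * mconv (fun x => (phi x `^ p)%R) w (V z) `^ p^-1))%E.

Let p_gt0 : 0 < p. Proof. exact: lt_trans p_gt1. Qed.

Let S_ge0 : (0 <= S)%E.
Proof. by apply: integral_ge0 => z _; rewrite mule_ge0 ?lee_fin// poweR_ge0. Qed.

(** Hölder for the dilated weight w(V x / u). By [dilV] the second Hölder factor is u times the
    undilated integral, and u^-1 is shared between the two factors with exponents 1/p and 1 -
    1/p. *)
Let minkowski_section (a : R -> R) (u : R) : mfun a -> (forall t, 0 <= a t) -> 0 < u ->
  (\int[mu]_x (u^-1 * (phi x * (w (V x / u) * a (V x / u) `^ (p - 1))))%:E <=
   mconv (fun x => (phi x `^ p)%R) w u `^ p^-1 *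
   (\int[mu]_y (w (V y) * a (V y) `^ p)%:E) `^ (1 - p^-1))%E.
Proof.
move=> ma a0 u0.
have ui0 : 0 <= u^-1 by rewrite invr_ge0 ltW.
rewrite /mconv ger0_norm ?(ltW u0)// !integralZE//; last 4 first.
- by meas.
- by move=> x; rewrite mulr_ge0 ?powR_ge0.
- by meas.
- by move=> x; rewrite !mulr_ge0 ?powR_ge0.
set Q := (\int[mu]_y (w (V y) * _)%:E)%E.
have mG : mfun (fun t => `|w t * a t `^ p|%:E) by meas.
have ui_gt0 : 0 < u^-1 by rewrite invr_gt0.
have := @dilV u^-1 _ ui_gt0 mG (fun t => normr_ge0 _).
under eq_integral do rewrite ger0_norm ?mulr_ge0 ?powR_ge0// (mulrC u^-1).
under [X in _ = (_ * X)%E -> _]eq_integral do rewrite ger0_norm ?mulr_ge0 ?powR_ge0//.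
rewrite invrK -[X in _ = (_ * X)%E -> _]/Q => HQ.
have Q0 : (0 <= Q)%E.
  by apply: integral_ge0 => x _; rewrite lee_fin mulr_ge0 ?powR_ge0.
have -> : Q = (u^-1%:E * (u%:E * Q))%E.
  by rewrite muleA -EFinM mulVf ?gt_eqF// mul1e.
rewrite -HQ.
set A := (\int[mu]_x (phi x `^ p * _)%:E)%E.
set B := (\int[mu]_x (w (V x / u) * _)%:E)%E.
have A0 : (0 <= A)%E.
  by apply: integral_ge0 => x _; rewrite lee_fin mulr_ge0 ?powR_ge0.
have B0 : (0 <= B)%E.
  by apply: integral_ge0 => x _; rewrite lee_fin mulr_ge0 ?powR_ge0.
have p1E : p^-1 + (1 - p^-1) = 1 by rewrite addrC subrK.
have uiE : ((u^-1)%:E = (u^-1)%:E `^ p^-1 * (u^-1)%:E `^ (1 - p^-1))%E.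
  by rewrite !poweR_EFin -EFinM -powRD p1E ?powRr1 ?oner_eq0.
rewrite (poweRM _ _ A0) ?lee_fin// (poweRM _ _ B0) ?lee_fin// muleACA -uiE.
apply: lee_wpmul2l; first by rewrite lee_fin.
rewrite /A /B.
apply: (@weighted_hoelder p phi (fun x => w (V x / u)) (fun x => a (V x / u))) => //; meas.
Qed.

(** Duality with the test function w a^(p-1). With Q the integral on the left, a^p <= a^(p-1)
    [mconv phi k]; exchanging the integrals by [tonelli_quotient] and applying [minkowski_section]
    for each z gives Q <= S Q^(1 - 1/p). As Q is finite, Q^(1 - 1/p) can be divided out. *)
Let minkowski_truncated (a : R -> R) : mfun a -> (forall t, 0 <= a t) ->
  (forall t, 0 < t -> ((a t)%:E <= mconv phi k t)%E) ->
  (\int[mu]_y (w (V y) * a (V y) `^ p)%:E < +oo)%E ->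
  ((\int[mu]_y (w (V y) * a (V y) `^ p)%:E) `^ p^-1 <= S)%E.
Proof.
move=> ma a0 aA; set Q := (\int[mu]_y _)%E => Qoo.
have Q0 : (0 <= Q)%E.
  by apply: integral_ge0 => x _; rewrite lee_fin mulr_ge0 ?powR_ge0.
have p10 : 0 < 1 - p^-1 by rewrite subr_gt0 invf_lt1.
suff QS : (Q <= S * Q `^ (1 - p^-1))%E.
  have [->|Qn0] := eqVneq Q 0%E; first by rewrite poweR0r ?invr_eq0 ?gt_eqF.
  have Qp0 : (0 < Q)%E by rewrite lt_def Qn0.
  rewrite -(@lee_pmul2r _ (Q `^ (1 - p^-1))%E) ?poweR_gt0//; last first.
    by rewrite fin_num_poweR// ge0_fin_numE.
  rewrite -poweRD; last by rewrite poweRD_defE addrC subrK oner_eq0.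
  by rewrite addrC subrK poweRe1.
pose P t := w t * a t `^ (p - 1).
have mP : mfun P by rewrite /P; meas.
have P0 t : 0 <= P t by rewrite mulr_ge0 ?powR_ge0.
have mA : mfun (mconv phi k) by exact: measurable_mconv.
apply: (@le_trans _ _ (\int[mu]_y ((P (V y))%:E * mconv phi k (V y)))%E).
  apply: ge0_le_integral => //.
  - by move=> y _; rewrite lee_fin mulr_ge0 ?powR_ge0.
  - by meas.
  - by meas.
  move=> y _; have [Vy0|Vy0] := eqVneq (V y) 0.
    by rewrite Vy0 /P w0 !mul0r mul0e.
  have -> : a (V y) `^ p = a (V y) `^ (p - 1) * a (V y).
    have pE : p - 1 + 1 = p by rewrite subrK.
    by have := @powRD R (a (V y)) (p - 1) 1; rewrite pE gt_eqF// powRr1// => ->.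
  rewrite mulrA EFinM; apply: lee_wpmul2l; first by rewrite lee_fin P0.
  by rewrite aA// lt_def Vy0 V0.
under eq_integral.
  move=> y _; rewrite /mconv ger0_norm// -integralZE//; last 2 first.
  - by meas.
  - by move=> x; rewrite !mulr_ge0 ?invr_ge0.
  over.
rewrite (tonelli_quotient phi P k)//; last by rewrite /P w0 mul0r.
rewrite /S -ge0_integralZr//; last 3 first.
- have : mfun (mconv (fun x => phi x `^ p) w).
    by apply: measurable_mconv => //; [meas | move=> x; rewrite powR_ge0].
  by move=> ?; meas.
- by move=> z _; rewrite mule_ge0 ?lee_fin ?poweR_ge0.
- by rewrite poweR_ge0.
apply: ge0_le_integral => //.
- by move=> z _; apply: integral_ge0 => x _; rewrite lee_fin !mulr_ge0 ?invr_ge0 ?powR_ge0.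
- apply: (@measurable_fun_fubini_tonelli_F _ _ _ _ _ mu
    (fun z : T * T => ((V z.1)^-1 * k (V z.1) * (phi z.2 * P (V z.2 / V z.1)))%:E)).
    by meas.
  by move=> z; rewrite lee_fin !mulr_ge0 ?invr_ge0 ?powR_ge0.
- have : mfun (mconv (fun x => phi x `^ p) w).
    by apply: measurable_mconv => //; [meas | move=> x; rewrite powR_ge0].
  by move=> ?; meas.
move=> z _; have [Vz0|Vz0] := eqVneq (V z) 0.
  rewrite Vz0 k0 !mul0e; rewrite integral0_eq// => x _.
  by rewrite mulr0 mul0r.
under eq_integral do rewrite (mulrC (V z)^-1) -mulrA.
rewrite integralZE//; last 2 first.
- by meas.
- by move=> x; rewrite !mulr_ge0 ?invr_ge0 ?powR_ge0.
rewrite -muleA; apply: lee_wpmul2l; first by rewrite lee_fin.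
by apply: minkowski_section => //; rewrite lt_def Vz0 V0.
Qed.

(** The convolution cut off in height, in radius and where the weight is large, so that its weighted
    p-th moment is finite, as the division in [minkowski_truncated] demands. *)
Let trunc (m : nat) (t : R) : R :=
  if (w t <= m.+1%:R) && (t < m.+1%:R) then fine (mine (mconv phi k t) m.+1%:R%:E)
  else 0.

Let trunc_fin m t : (mine (mconv phi k t) m.+1%:R%:E \is a fin_num)%E.
Proof.
rewrite ge0_fin_numE; last by rewrite le_min mconv_ge0//= lee_fin.
by rewrite gt_min ltry orbT.
Qed.

Let mtrunc m : mfun (trunc m).
Proof.
have mA : mfun (mconv phi k) by exact: measurable_mconv.
rewrite /trunc; apply: measurable_fun_ifT; [by meas| |by meas].
apply: measurableT_comp; first exact: fine_measurable.
exact: measurable_mine.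
Qed.

Let trunc_ge0 m t : 0 <= trunc m t.
Proof.
rewrite /trunc; case: ifPn => // _; apply: fine_ge0.
by rewrite le_min mconv_ge0//= lee_fin.
Qed.

Let trunc_le m t : ((trunc m t)%:E <= mconv phi k t)%E.
Proof.
rewrite /trunc; case: ifPn => _; last exact: mconv_ge0.
by rewrite fineK// ge_min lexx.
Qed.

Let trunc_nd t : {homo trunc^~ t : m n / (m <= n)%N >-> m <= n}.
Proof.
move=> m n mn; have mn1 : m.+1%:R <= n.+1%:R :> R by rewrite ler_nat.
rewrite {1}/trunc; case: ifPn => // /andP[wm tm].
rewrite /trunc (le_trans wm mn1) (lt_le_trans tm mn1)/=.
rewrite fine_le// le_min ge_min lexx/= ge_min.
by rewrite lee_fin mn1 orbT.
Qed.

(** With M = m + 1 the integrand is at most M M^p on {0 < V < M} and 0 elsewhere, and that set has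
    measure M by [dilV] and [unitV]. *)
Let trunc_lty m : (\int[mu]_y (w (V y) * trunc m (V y) `^ p)%:E < +oo)%E.
Proof.
set M : R := m.+1%:R; have M0 : 0 < M by rewrite ltr0n.
pose G (t : R) : R := if 0 < t < 1 then 1 else 0.
have mG : mfun G by rewrite /G; meas.
have G0 t : 0 <= G t by rewrite /G; case: ifPn.
have mA : measurable [set x : T | 0 < V x < 1] by apply: measurable_bool; meas.
have GE : (\int[mu]_x (G (V x))%:E = 1)%E.
  rewrite -unitV -[in RHS](setIT [set x : T | _]) -integral_indic//.
  apply: eq_integral => x _; rewrite indicE /G; congr EFin.
  by case: ifPn => h; [rewrite mem_set|rewrite memNset//; exact/negP].
have mGE : mfun (fun t => (G t)%:E) by meas.
have Mi0 : 0 < M^-1 by rewrite invr_gt0.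
have := @dilV M^-1 _ Mi0 mGE (fun t => G0 t).
rewrite GE mule1 invrK => HG.
apply: (@le_lt_trans _ _ (\int[mu]_x (M * M `^ p * G (M^-1 * V x))%:E)%E); last first.
  rewrite integralZE ?mulr_ge0 ?powR_ge0 ?(ltW M0)// ?HG -?EFinM ?ltry//.
  by meas.
have mt := mtrunc m.
apply: ge0_le_integral => //.
- by move=> x _; rewrite lee_fin mulr_ge0 ?powR_ge0.
- by meas.
- by meas.
move=> x _; rewrite lee_fin.
have [->|x0] := eqVneq (V x) 0; first by rewrite w0 mul0r !mulr_ge0 ?powR_ge0 ?(ltW M0) ?G0.
have Vx0 : 0 < V x by rewrite lt_def x0 V0.
rewrite /trunc; case: ifPn => [/andP[wm tm]|_]; last first.
  by rewrite powR0 ?gt_eqF// mulr0 !mulr_ge0 ?powR_ge0 ?(ltW M0) ?G0.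
rewrite /G mulr_gt0//= (mulrC M^-1) ltr_pdivrMr// mul1r tm mulr1.
apply: ler_pM => //; first exact: powR_ge0.
apply: ge0_ler_powR; rewrite ?nnegrE ?(ltW p_gt0)//.
- by apply: fine_ge0; rewrite le_min mconv_ge0//= lee_fin.
- by rewrite -lee_fin fineK// ge_min lexx orbT.
Qed.

(** If the convolution is finite at [t], some truncation is already exact there. If it is infinite
    and [w t > 0], the truncated terms are unbounded; if [w t = 0], the left side is 0. *)
Let le_limn_trunc t : 0 <= t ->
  ((w t)%:E * mconv phi k t `^ p <=
   limn (fun m => (w t * trunc m t `^ p)%:E))%E.
Proof.
move=> t0; set g := (fun m : nat => _).
have A0 : (0 <= mconv phi k t)%E by exact: mconv_ge0.
have nd : nondecreasing_seq g.
  move=> m n mn; rewrite lee_fin; apply: ler_wpM2l; first exact: w_ge0.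
  by apply: ge0_ler_powR; rewrite ?nnegrE ?(ltW p_gt0)//; exact: trunc_nd.
rewrite (cvg_lim _ (ereal_nondecreasing_cvgn nd))//.
have le_sup m : (g m <= ereal_sup (range g))%E.
  by apply: ereal_sup_ubound; exists m.
have [wt0|wt0] := eqVneq (w t) 0.
  by rewrite wt0 mul0e (le_trans _ (le_sup 0%N))// lee_fin wt0 mul0r.
have wt : 0 < w t by rewrite lt_def wt0 w_ge0.
have key (r : R) : 0 <= r -> exists m : nat, [/\ w t <= m.+1%:R, t < m.+1%:R & r <= m.+1%:R].
  move=> r0; exists (Num.bound (w t + t + r)).
  have wtr : 0 <= w t + t + r by rewrite !addr_ge0.
  have := archi_boundP wtr; rewrite -natr1; set B := _%:R; have := w_ge0 t.
  by move=> ? ?; split; lra.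
case AE : (mconv phi k t) A0 => [r| |//] r0.
  have [m [wm tm rm]] := key r r0.
  apply: le_trans (le_sup m); rewrite /g /trunc wm tm/= AE.
  by rewrite min_l ?lee_fin//= poweR_EFin -EFinM.
(* Here [trunc m t] equals m + 1, and w(t) (m + 1)^p >= w(t) (m + 1) >= |r| once m + 1 exceeds |r| /
   w(t). *)
suff -> : ereal_sup (range g) = +oo%E by rewrite leey.
apply: eq_infty => r.
have [m [wm tm rm]] := key (`|r| / w t) ltac:(by rewrite divr_ge0).
apply: le_trans (le_sup m); rewrite /g /trunc wm tm/= AE min_r ?leey//=.
rewrite lee_fin (le_trans (ler_norm r))//.
rewrite ler_pdivrMr// in rm; rewrite (le_trans rm)// mulrC ler_wpM2l//.
by rewrite -[leLHS]powRr1// ler_powR ?(ltW p_gt1)// ler1n.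
Qed.

(** Every truncation obeys the bound [S], which does not depend on m; monotone convergence, applied
    to the p-th powers, removes the truncation. *)
Lemma mult_minkowski :
  ((\int[mu]_y ((w (V y))%:E * mconv phi k (V y) `^ p)) `^ p^-1 <= S)%E.
Proof.
have mA : mfun (mconv phi k) by exact: measurable_mconv.
have pVK : (S = (S `^ p) `^ p^-1)%E.
  by rewrite -poweRrM divff ?gt_eqF// poweRe1.
rewrite pVK; apply: gt0_ler_poweR.
- by rewrite invr_ge0 ltW.
- rewrite in_itv/= leey andbT; apply: integral_ge0 => y _.
  by rewrite mule_ge0 ?lee_fin// poweR_ge0.
- by rewrite in_itv/= leey andbT poweR_ge0.
have mt := mtrunc.
have mg m : mfun (fun y => (w (V y) * trunc m (V y) `^ p)%:E) by have mtm := mt m; meas.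
have g0 m y : setT y -> (0 <= (w (V y) * trunc m (V y) `^ p)%:E)%E.
  by move=> _; rewrite lee_fin mulr_ge0 ?powR_ge0.
have gnd y : setT y ->
    {homo (fun m => (w (V y) * trunc m (V y) `^ p)%:E) : m n / (m <= n)%N >-> (m <= n)%E}.
  move=> _ m n mn; rewrite lee_fin; apply: ler_wpM2l; first exact: w_ge0.
  by apply: ge0_ler_powR; rewrite ?nnegrE ?(ltW p_gt0)//; exact: trunc_nd.
apply: (@le_trans _ _ (\int[mu]_y limn (fun m => (w (V y) * trunc m (V y) `^ p)%:E))%E).
  apply: ge0_le_integral => //.
  - by move=> y _; rewrite mule_ge0 ?lee_fin ?poweR_ge0.
  - by meas.
  - apply: (emeasurable_fun_cvg (fun m y => (w (V y) * trunc m (V y) `^ p)%:E)) => //.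
    by move=> y _; apply: ereal_nondecreasing_is_cvgn; exact: gnd.
  - by move=> y _; exact: le_limn_trunc.
rewrite monotone_convergence//.
apply: lime_le.
  apply: ereal_nondecreasing_is_cvgn => m n mn.
  apply: (ge0_le_integral _ measurableT (g0 m) (mg m) (mg n)) => y yT.
  exact: gnd.
apply: nearW => m.
have := minkowski_truncated (trunc m) (mtrunc m) (trunc_ge0 m)
  (fun t _ => trunc_le m t) (trunc_lty m).
set Q := (\int[mu]_y _)%E => QS.
have Q0 : (0 <= Q)%E by apply: integral_ge0 => y _; exact: g0.
have -> : (Q = (Q `^ p^-1) `^ p)%E.
  by rewrite -poweRrM mulVf ?gt_eqF// poweRe1.
apply: gt0_ler_poweR QS; rewrite ?(ltW p_gt0)// in_itv/= leey andbT//.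
exact: poweR_ge0.
Qed.
End minkowski.
End radial.

Arguments integralZE {d T R} mu {a F}.
Arguments mconv {d T R} mu V psi h t.
Arguments measurable_mconv {d T R} mu {V} mV {psi h}.
Arguments mconv_ge0 {d T R} mu V {psi h} t.
Arguments mult_minkowski {d T R mu V} mV V0 dilV unitV {p phi w k}.

(** * Lebesgue measure of balls and dilations *)

Section outer_measure.
Context (R : realType) (n : nat).
Implicit Types (A : set 'rV[R]_n) (c : 'rV[R]_n * 'rV[R]_n).
Local Notation mu := (@lebesgue_outer R n).

Lemma esumZ_le (I : choiceType) (C : set I) (a : R) (f : I -> \bar R) :
  0 <= a -> (forall i, 0 <= f i)%E ->
  (\esum_(i in C) (a%:E * f i) <= a%:E * \esum_(i in C) f i)%E.
Proof.
move=> a0 f0; apply: ge_ereal_sup => _ [F [finF FC] <-].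
rewrite -ge0_mule_fsumr//; apply: lee_wpmul2l; first by rewrite lee_fin.
by apply: esum_ge; exists F.
Qed.

(** Covers are sets of boxes, so boxes that coincide under [e] are counted once in the image. The
    section [s] chooses one index for each image box, and the other indices only add nonnegative
    terms. *)
Lemma lebesgue_outer_le_esum A (C : set ('rV[R]_n * 'rV[R]_n))
    (e : 'rV[R]_n * 'rV[R]_n -> 'rV[R]_n * 'rV[R]_n) :
  countable C -> A `<=` \bigcup_(c in C) box (e c) ->
  (mu A <= \esum_(c in C) box_vol (e c))%E.
Proof.
move=> cC AC.
apply: (@le_trans _ _ (\esum_(c in e @` C) box_vol c)).
  apply: ereal_inf_lbound; exists (e @` C) => //; split.
    exact: sub_countable (card_image_le _ _) cC.
  by move=> x /AC[c Cc xc]; exists (e c) => //; exists c.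
have /choice[s sP] : forall y, exists c, (e @` C) y -> C c /\ e c = y.
  move=> y; have [[c Cc <-]|nCy] := pselect ((e @` C) y); first by exists c.
  by exists y => /nCy.
have -> : \esum_(c in e @` C) box_vol c = \esum_(c in e @` C) box_vol (e (s c)).
  by apply: eq_esum => y /sP[_ ->].
rewrite -(esum_image (e @` C) s (fun c => box_vol (e c))); last first.
  by move=> x y /set_mem/sP[_ xE] /set_mem/sP[_ yE] sxy; rewrite -xE -yE sxy.
rewrite esum_mkcond [leRHS]esum_mkcond; apply: le_esum => c _.
case: ifPn => [/set_mem[y /sP[Cs _] <-]|_]; first by rewrite mem_set.
by case: ifPn => // _; exact: box_vol_ge0.
Qed.

Lemma box_vol_scale (a : R) c : 0 < a ->
  box_vol (a *: c.1, a *: c.2) = ((a ^+ n)%:E * box_vol c)%E.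
Proof.
move=> a0; rewrite /box_vol -EFinM; congr EFin.
have -> : a ^+ n = \prod_(i < n) a by rewrite prodr_const card_ord.
rewrite -big_split/=; apply: eq_bigr => i _.
by rewrite !mxE -mulrBr maxr_pMr ?mulr0// ltW.
Qed.

Let lebesgue_outer_scale_le (a : R) A : 0 < a ->
  (mu [set x | A (a *: x)] <= (a^-1 ^+ n)%:E * mu A)%E.
Proof.
move=> a0; have an0 : 0 < a^-1 ^+ n by rewrite exprn_gt0// invr_gt0.
rewrite -lee_pdivrMl//; apply: le_ereal_inf_tmp => _ [C [cC AC] <-].
rewrite lee_pdivrMl//.
apply: (le_trans _ (esumZ_le _ C _ _ (ltW an0) (fun c => box_vol_ge0 c))).
under eq_esum do rewrite -box_vol_scale ?invr_gt0//.
apply: (lebesgue_outer_le_esum _ _ (fun c => (a^-1 *: c.1, a^-1 *: c.2))) => //.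
move=> x /AC[c Cc xc]; exists c => // i; move: (xc i); rewrite !mxE.
by rewrite ltr_pdivrMl ?ler_pdivlMl.
Qed.

(** Scaling the boxes of a cover gives one inequality; the other one is the same inequality for the
    factor [a^-1]. *)
Lemma lebesgue_outer_scale (a : R) A : 0 < a ->
  mu [set x | A (a *: x)] = ((a^-1 ^+ n)%:E * mu A)%E.
Proof.
move=> a0; apply/eqP; rewrite eq_le lebesgue_outer_scale_le//=.
rewrite -lee_pdivlMl ?exprn_gt0 ?invr_gt0// -exprVn.
have := @lebesgue_outer_scale_le a^-1 [set x | A (a *: x)].
rewrite invr_gt0 => /(_ a0); congr (mu _ <= _)%E.
by apply/funext => x /=; rewrite scalerA divff ?gt_eqF// scale1r.
Qed.

(** The hyperplane cuts every box of a cover into two boxes [lo] and [hi], again half-open, whose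
    volumes add up to that of the box. This is Carathéodory's condition. *)
Lemma measurable_halfspace (i : 'I_n) (t : R) :
  measurable ([set x : euclid R n | (x : 'rV[R]_n) 0 i <= t]).
Proof.
apply: le_caratheodory_measurable => X.
set H := [set x : 'rV[R]_n | x 0 i <= t].
apply: le_ereal_inf_tmp => _ [C [cC XC] <-].
pose lo c : 'rV[R]_n * 'rV[R]_n :=
  (c.1, \row_j (if j == i then Num.min (c.2 0 j) t else c.2 0 j)).
pose hi c : 'rV[R]_n * 'rV[R]_n :=
  (\row_j (if j == i then Num.max (c.1 0 j) t else c.1 0 j), c.2).
have -> : \esum_(c in C) box_vol c =
    (\esum_(c in C) box_vol (lo c) + \esum_(c in C) box_vol (hi c))%E.
  rewrite -esumD; [|by move=> c _; exact: box_vol_ge0|by move=> c _; exact: box_vol_ge0].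
  apply: eq_esum => c _; rewrite /box_vol -EFinD; congr EFin.
  rewrite (bigD1 i)//= [X in _ = X + _](bigD1 i)//= [X in _ = _ + X](bigD1 i)//=.
  rewrite !mxE eqxx.
  under [X in _ = _ * X + _]eq_bigr => j /negPf ji do rewrite mxE ji.
  under [X in _ = _ + _ * X]eq_bigr => j /negPf ji do rewrite mxE ji.
  rewrite -mulrDl; congr (_ * _).
  (* Only the i-th side changes: max(0, v - u) = max(0, min(v, t) - u) + max(0, v - max(u, t)), also
     for empty boxes. *)
  move: (c.1 0 i) (c.2 0 i) => u v.
  by rewrite !maxEle minEle; do ![case: ifPn => //]; lra.
apply: leeD; apply: lebesgue_outer_le_esum => // x [/XC[c Cc xc] xt]; exists c => // j.
- have /andP[-> xj] := xc j; rewrite mxE; case: eqP => // ->.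
  by rewrite le_min; have /andP[_ ->] := xc i; exact: xt.
- have /andP[xj ->] := xc j; rewrite mxE andbT; case: eqP => // ->.
  by rewrite gt_max; have /andP[-> _] := xc i; rewrite ltNge; apply/negP.
Qed.

End outer_measure.

(** * Measurability of the Euclidean norm; balls have finite measure *)

Section enorm.
Local Set Implicit Arguments.
Local Unset Strict Implicit.
Context (R : realType) (n : nat).
Local Notation E := (euclid R n).
Local Notation mu := (@lebesgue_rV R n).

Lemma measurable_coord (i : 'I_n) :
  measurable_fun [set: E] (fun x : E => (x : 'rV[R]_n) 0 i).
Proof.
move=> mT; apply: (measurability _ (RGenInftyO.measurableE R)) => //.
move=> _ [_ [t ->] <-]; rewrite setTI.
rewrite [X in measurable X](_ : _ =
  \bigcup_(k : nat) [set x : E | (x : 'rV[R]_n) 0 i <= t - k.+1%:R^-1]).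
  by apply: bigcupT_measurable => k; exact: measurable_halfspace.
apply/seteqP; split => x /=.
  rewrite in_itv/= => xt.
  have /ltr_add_invr[k xk] := xt; exists k => //=.
  by rewrite lerBrDr ltW.
by move=> [k _ /= xk]; rewrite in_itv/=; apply: le_lt_trans xk _; rewrite gtrBl invr_gt0.
Qed.

Lemma enorm_ge0 (x : 'rV[R]_n) : 0 <= enorm x.
Proof. exact: sqrtr_ge0. Qed.

Lemma enormZ (a : R) (x : 'rV[R]_n) : enorm (a *: x) = `|a| * enorm x.
Proof.
rewrite /enorm -sqrtr_sqr -sqrtrM ?sqr_ge0// mulr_sumr.
by congr Num.sqrt; apply: eq_bigr => i _; rewrite mxE exprMn.
Qed.

Lemma le_coord_enorm (x : 'rV[R]_n) i : `|x 0 i| <= enorm x.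
Proof.
rewrite -sqrtr_sqr ler_sqrt ?sumr_ge0// => [|j _]; last exact: sqr_ge0.
by rewrite (bigD1 i)//= lerDl sumr_ge0// => j _; exact: sqr_ge0.
Qed.

Lemma measurable_enorm : measurable_fun [set: E] (@enorm R n).
Proof.
have -> : @enorm R n = fun x => (\sum_(i < n) x 0 i ^+ 2) `^ 2^-1.
  by apply/funext => x; rewrite powR12_sqrt// sumr_ge0// => i _; exact: sqr_ge0.
apply: measurable_fun_powRr.
apply: (@measurable_sum _ _ _ _ _ _ (fun i (x : E) => (x : 'rV[R]_n) 0 i ^+ 2)) => i.
by apply: measurable_funX; exact: measurable_coord.
Qed.

Lemma measurable_cball (rho : R) : measurable (cball rho : set E).
Proof.
apply: measurable_bool; apply: measurable_fun_ltr; last exact: measurable_cst.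
exact: measurable_enorm.
Qed.

Lemma measurable_enorm_le0 : measurable [set x : E | enorm x <= 0].
Proof.
apply: measurable_bool; apply: measurable_fun_ler; last exact: measurable_cst.
exact: measurable_enorm.
Qed.

Lemma cball_fin_num (rho : R) : (mu (cball rho) \is a fin_num)%E.
Proof.
rewrite ge0_fin_numE//.
pose c : 'rV[R]_n * 'rV[R]_n := (const_mx (- rho), const_mx rho).
have /le_lt_trans : (mu (cball rho) <= \esum_(c in [set c]) box_vol c)%E.
  apply: (lebesgue_outer_le_esum _ _ _ [set c] id) => //.
  move=> x /= xr; exists c => // i; rewrite !mxE.
  have := le_lt_trans (le_coord_enorm x i) xr.
  by rewrite ltr_norml => /andP[-> /ltW].
by apply; rewrite esum_set1 ?box_vol_ge0// ltry.
Qed.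

Lemma cball_bigcup : \bigcup_(k : nat) cball k%:R = [set: E].
Proof.
apply/seteqP; split => // x _; exists (Num.bound (enorm x)) => //.
by rewrite /cball/= archi_boundP// enorm_ge0.
Qed.

Lemma sigma_finite_lebesgue_rV : sigma_finite [set: E] mu.
Proof.
exists (fun k => cball k%:R); first by rewrite cball_bigcup.
by move=> k; split; [exact: measurable_cball|rewrite -ge0_fin_numE// cball_fin_num].
Qed.

End enorm.

HB.instance Definition _ (R : realType) (n : nat) :=
  Measure_isSigmaFinite.Build _ _ _ (@lebesgue_rV R n) (@sigma_finite_lebesgue_rV R n).

(** * Dilations of R^n and the function V *)

Section dilation.
Local Set Implicit Arguments.
Local Unset Strict Implicit.
Context (R : realType) (n : nat).
Local Notation E := (euclid R n).
Local Notation mu := (@lebesgue_rV R n).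

(** Carathéodory's condition for the preimage of [A] and a test set [X] is, up to the factor a^-n,
    the condition for [A] and the test set a X, called [Y]. *)
Lemma measurable_dilation (a : R) : 0 < a ->
  measurable_fun [set: E] (fun x : E => (a *: (x : 'rV[R]_n)) : E).
Proof.
move=> a0 _ A mA; rewrite setTI; apply: le_caratheodory_measurable => X.
pose Y : set 'rV[R]_n := [set x | X (a^-1 *: x)].
have -> : X = [set x | Y (a *: x)].
  by apply/funext => x; rewrite /Y/= scalerA mulVf ?gt_eqF// scale1r.
have := lebesgue_outer_scale R n a (Y `&` A) a0.
have := lebesgue_outer_scale R n a (Y `&` ~` A) a0.
move=> /= -> ->.
rewrite lebesgue_outer_scale// -ge0_muleDr ?lebesgue_outer_ge0//.
by rewrite -(mA Y).
Qed.

Lemma pushforward_dilation (a : R) (A : set E) : 0 < a ->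
  pushforward mu (fun x : E => (a *: (x : 'rV[R]_n)) : E) A =
  ((a^-1 ^+ n)%:E * mu A)%E.
Proof. exact: lebesgue_outer_scale. Qed.

Lemma integral_dilation (a : R) (G : E -> \bar R) : 0 < a ->
  measurable_fun [set: E] G -> (forall x, 0 <= G x)%E ->
  (\int[mu]_x G ((a *: (x : 'rV[R]_n)) : E) = (a^-1 ^+ n)%:E * \int[mu]_x G x)%E.
Proof.
move=> a0 mG G0.
have k0 : 0 <= a^-1 ^+ n by rewrite exprn_ge0// invr_ge0 ltW.
pose mdil := measurable_dilation a0.
have := ge0_integral_pushforward mdil mu measurableT mG (fun y _ => G0 y).
rewrite preimage_setT => <-.
transitivity (\int[mscale (NngNum k0) mu]_x G x)%E; last exact: ge0_integral_mscale.
refine (@eq_measure_integral _ _ _ _ _ _ _ _) => A mA AT.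
exact: pushforward_dilation.
Unshelve. exact: mdil.
Qed.

Lemma cball_le0 (rho : R) : rho <= 0 -> cball rho = set0 :> set E.
Proof.
by move=> rho0; rewrite -subset0 => x /=; rewrite /cball/= ltNge (le_trans rho0)// enorm_ge0.
Qed.

Lemma lebesgue_rV_cball (rho : R) : 0 < rho ->
  mu (cball rho) = ((rho ^+ n)%:E * mu (cball 1))%E.
Proof.
move=> rho0; have r0 : 0 < rho^-1 by rewrite invr_gt0.
have := lebesgue_outer_scale R n rho^-1 (cball 1) r0; rewrite invrK => <-.
congr (lebesgue_outer _); apply/funext => x; rewrite /cball/= enormZ gtr0_norm//.
by rewrite ltr_pdivrMl// mulr1.
Qed.

Lemma vol_ge0 (rho : R) : 0 <= @vol R n rho.
Proof. exact: fine_ge0. Qed.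

Lemma volE (rho : R) : 0 < rho -> vol n rho = rho ^+ n * vol n 1.
Proof.
by move=> rho0; rewrite /vol lebesgue_rV_cball// fineM// cball_fin_num.
Qed.

Lemma vol0 (rho : R) : rho <= 0 -> vol n rho = 0.
Proof. by move=> rho0; rewrite /vol cball_le0// measure0. Qed.

Context (n_gt0 : (0 < n)%N).

Lemma vol_enormE (x : E) : vol n (enorm x) = enorm x ^+ n * vol n 1.
Proof.
have := enorm_ge0 x; rewrite le_eqVlt => /predU1P[<-|]; last exact: volE.
by rewrite vol0// expr0n gtn_eqF// mul0r.
Qed.

Context (vol1_gt0 : 0 < vol n 1 :> R).

Lemma ltr_vol (rho sigma : R) : 0 <= rho -> (vol n rho < vol n sigma) = (rho < sigma).
Proof.
rewrite le_eqVlt => /predU1P[<-|rho0].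
  rewrite vol0//; have [s0|s0] := ltP 0 sigma.
    by rewrite (volE s0) mulr_gt0// exprn_gt0.
  by rewrite (vol0 s0) ltxx.
have [s0|s0] := ltP 0 sigma.
  by rewrite (volE rho0) (volE s0) ltr_pM2r// ltr_pXn2r// nnegrE ltW.
rewrite (vol0 s0) (volE rho0) !ltNge (le_trans s0 (ltW rho0))/=.
by rewrite mulr_ge0 ?vol_ge0 ?exprn_ge0 ?(ltW rho0).
Qed.

Local Notation V := (fun x : E => vol n (enorm x)).

Lemma measurable_vol_enorm : measurable_fun [set: E] V.
Proof.
rewrite (_ : V = fun x : E => enorm x ^+ n * vol n 1); last first.
  by apply/funext => x; exact: vol_enormE.
apply: measurable_funM; last exact: measurable_cst.
by apply: measurable_funX; exact: measurable_enorm.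
Qed.

(** Dilating x by a = c^(1/n) multiplies V x by c and Lebesgue measure by a^n = c. *)
Lemma vol_dilation (c : R) (G : R -> \bar R) : 0 < c ->
  measurable_fun [set: R] G -> (forall t, 0 <= G t)%E ->
  (\int[mu]_x G (c * V x)%R = c^-1%:E * \int[mu]_x G (V x))%E.
Proof.
move=> c0 mG G0; pose a := c `^ n%:R^-1.
have a0 : 0 < a by rewrite powR_gt0.
have an : a ^+ n = c.
  by rewrite -powR_mulrn ?powR_ge0// -powRrM mulVf ?powRr1 ?(ltW c0)// pnatr_eq0 -lt0n.
have mGV : measurable_fun [set: E] (fun x => G (V x)).
  by apply: (measurableT_comp mG); exact: measurable_vol_enorm.
rewrite -an -exprVn -(integral_dilation a0 mGV (fun x => G0 _)).
apply: eq_integral => x _; congr G.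
by rewrite !vol_enormE enormZ gtr0_norm// exprMn mulrA.
Qed.

(** The set is invariant under doubling, so its finite measure m satisfies m = 2^-n m with n > 0. *)
Lemma lebesgue_rV_enorm0 : mu [set x : E | enorm x <= 0] = 0%E.
Proof.
set Z := (X in mu X).
have mZ : measurable Z by exact: measurable_enorm_le0.
have Zfin : (mu Z \is a fin_num)%E.
  rewrite ge0_fin_numE//; apply: (@le_lt_trans _ _ (mu (cball 1))).
    apply: le_measure; rewrite ?inE//; first exact: measurable_cball.
    by move=> x /= x0; rewrite /cball/= (le_lt_trans x0).
  by rewrite -ge0_fin_numE// cball_fin_num.
have := lebesgue_outer_scale R n 2 Z ltac:(by []).
have -> : [set x | Z (2 *: x)] = Z.
  by apply/funext => x; rewrite /Z/= enormZ pmulr_rle0// gtr0_norm.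
rewrite -[lebesgue_outer _]/(mu Z) -(fineK Zfin) -EFinM => /eqP.
rewrite eqe -subr_eq0 -{1}(mul1r (fine _)) -mulrBl mulf_eq0 subr_eq0 => /orP[/eqP h|/eqP -> //].
have : 2^-1 ^+ n < 1 :> R by rewrite exprn_ilt1// ?gtn_eqF// invf_lt1// ltr1n.
by rewrite -h ltxx.
Qed.

(** [rho] is the radius of the ball of volume 1; the set is this ball without the origin, which is
    null. *)
Lemma vol_normalised : mu [set x : E | 0 < V x < 1] = 1%E.
Proof.
pose rho := ((vol n 1)^-1 : R) `^ n%:R^-1.
have rho0 : 0 < rho by rewrite powR_gt0// invr_gt0.
have rhon : vol n rho = 1.
  rewrite (volE rho0) -powR_mulrn ?powR_ge0// -powRrM mulVf ?powRr1 ?invr_ge0 ?vol_ge0//.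
    by rewrite mulVf// gt_eqF.
  by rewrite pnatr_eq0 -lt0n.
have : (mu (cball rho) = 1)%E by rewrite -rhon /vol fineK// cball_fin_num.
have mZ := @measurable_enorm_le0 R n.
have mV := measurable_vol_enorm.
rewrite (measureDI mu (@measurable_cball R n rho) mZ) => <-.
rewrite [X in _ = (_ + X)%E](_ : _ = 0%E) ?adde0; last first.
  apply/eqP; rewrite eq_le measure_ge0 andbT -lebesgue_rV_enorm0.
  apply: le_measure; rewrite ?inE//; apply: measurableI => //; exact: measurable_cball.
congr (mu _); apply/seteqP; split => x /=.
  move=> /andP[V0 V1]; split; first by rewrite /cball/= -ltr_vol ?enorm_ge0// rhon.
  by move=> x0; move: V0; rewrite vol0// ltxx.
move=> [xr /negP]; rewrite -ltNge => x0; apply/andP; split.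
  by rewrite -(vol0 (lexx 0)) ltr_vol.
by rewrite -rhon ltr_vol// enorm_ge0.
Qed.

End dilation.

(** * Functions in CMO are bounded *)

(** Keep only the term k = 1 of the series: its factor 2^(-n|alpha - 1|) cancels against the
    constant in front, and the remaining product is at least 3^r >= 2^r. *)
Lemma c1_ge2 (R : realType) (n : nat) (r alpha : R) : 0 < r ->
  (2%:E <= c1 n r alpha)%E.
Proof.
move=> r0; rewrite /c1; set C := (_ * _ * _ * _ * _)%R.
pose u (k : nat) : \bar R := ((2 : R) `^ (- (k%:R * n%:R * `|alpha - 1|)) * k%:R `^ r)%:E.
have u0 k : (0 <= u k)%E by rewrite lee_fin mulr_ge0 ?powR_ge0.
have -> : 2%:E = ((2 `^ r)%:E `^ r^-1)%E :> \bar R.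
  by rewrite poweR_EFin -powRrM divff ?gt_eqF// powRr1.
apply: gt0_ler_poweR.
- by rewrite invr_ge0 ltW.
- by rewrite in_itv/= leey andbT lee_fin powR_ge0.
- rewrite in_itv/= leey andbT mule_ge0//; last by apply: nneseries_ge0 => k _ _; exact: u0.
  by rewrite lee_fin !mulr_ge0 ?powR_ge0.
apply: (@le_trans _ _ (C%:E * u 1%N)%E); last first.
  apply: lee_wpmul2l; first by rewrite lee_fin !mulr_ge0 ?powR_ge0.
  apply: (@le_trans _ _ (\sum_(0 <= k < 2) u k)%E); last first.
    by apply: nneseries_lim_ge => k _ _; exact: u0.
  by rewrite big_nat_recl// big_nat1 leeDr.
rewrite -EFinM lee_fin /C powR1 mulr1 mul1r powRN.
set A1 := 2 `^ (n%:R * `|alpha|); set D := 2 `^ (n%:R * `|alpha - 1|).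
set A2 := 2 `^ (2 * _ * r).
have D0 : D != 0 by rewrite gt_eqF// powR_gt0.
have -> : A1 * D * 3 `^ r * 4 * A2 / D = (A1 * A2) * (3 `^ r * 4) by field.
have h1 (x : R) : 0 <= x -> 1 <= 2 `^ x.
  by move=> x0; rewrite -[leLHS](powRr0 2) ler_powR// ler1n.
apply: (@le_trans _ _ (1 * 3 `^ r)).
  by rewrite mul1r; apply: ge0_ler_powR; rewrite ?nnegrE ?(ltW r0) ?ler0n ?ler_nat.
apply: ler_pM; rewrite ?powR_ge0//.
  by rewrite -[leLHS]mul1r ler_pM// h1// !mulr_ge0// ltW.
by rewrite ler_peMr ?powR_ge0// ler1n.
Qed.

(* Chebyshev's inequality for the p-th moments, with p -> oo *)
Lemma negligible_moments d (T : measurableType d) (R : realType)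
    (mu : {measure set T -> \bar R}) (B : set T) (g : T -> R) (v N a : R) :
  measurable B -> (mu B < +oo)%E -> measurable_fun [set: T] g ->
  (forall x, 0 <= g x) -> 0 <= N -> N < a ->
  (forall p, 1 <= p -> (\int[mu]_(x in B) (g x `^ p)%:E <= (v * N `^ p)%:E)%E) ->
  mu.-negligible (B `&` [set x | a <= g x]).
Proof.
move=> mB Boo mg g0 N0 Na gN; set A := _ `&` _.
have a0 : 0 < a by rewrite (le_lt_trans N0).
have mA : measurable A.
  by apply: measurableI => //; apply: measurable_bool; meas.
have Afin : (mu A \is a fin_num)%E.
  rewrite ge0_fin_numE//; apply: le_lt_trans Boo.
  by apply: le_measure; rewrite ?inE// => x [].
exists A; split => //; rewrite -(fineK Afin); congr EFin; apply/eqP.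
rewrite eq_le fine_ge0// andbT; set m := fine _.
(* Chebyshev for p = k + 1 gives m <= v (N/a)^(k+1). The shift ensures p >= 1 and accounts for the
   first term v (N/a). *)
have key (k : nat) : m <= geometric (v * (N / a)) (N / a) k.
  pose p : R := k.+1%:R.
  have p1 : 1 <= p by rewrite ler1n.
  have p0 : 0 <= p by exact: le_trans p1.
  have ap0 : 0 < a `^ p by rewrite powR_gt0.
  have mF : measurable_fun [set: T] (fun x => (g x `^ p)%:E) by meas.
  have : ((a `^ p)%:E * mu A <= (v * N `^ p)%:E)%E.
    apply: le_trans (gN p p1).
    rewrite -(integral_cst mu mA).
    apply: (@le_trans _ _ (\int[mu]_(x in A) (g x `^ p)%:E)%E).
      apply: ge0_le_integral => //.
      - by move=> x _; rewrite lee_fin powR_ge0.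
      - exact: measurable_funTS.
      move=> x [_ /= ax]; rewrite lee_fin.
      by apply: ge0_ler_powR; rewrite ?nnegrE ?(ltW a0) ?g0.
    apply: ge0_subset_integral => //.
    - exact: measurable_funTS.
    - by move=> x _; rewrite lee_fin powR_ge0.
    - by move=> x [].
  rewrite -(fineK Afin) -EFinM lee_fin -/m -ler_pdivlMl// => /le_trans; apply.
  rewrite /geometric/= -mulrA -exprS expr_div_n !powR_mulrn ?(ltW a0)//.
  by rewrite [leLHS]mulrC mulrA.
have Na1 : `|N / a| < 1.
  by rewrite ger0_norm ?divr_ge0 ?(ltW a0)// ltr_pdivrMr// mul1r.
have cv := @cvg_geometric R (v * (N / a)) _ Na1.
rewrite -(cvg_lim _ cv)//; apply: limr_ge; first exact: cvgP cv.
exact: nearW.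
Qed.

Lemma CMO_norm_ge0 (R : realType) (n : nat) (b : euclid R n -> R) :
  (0 <= CMO_norm b)%E.
Proof.
apply: (@le_trans _ _ (CMOp_norm 1 b)); last by apply: ereal_sup_ubound; exists 1 => /=.
apply: (@le_trans _ _ (((vol n 1)^-1%:E *
      \int[@lebesgue_rV R n]_(x in cball 1) (`|b x - ball_avg b 1| `^ 1)%:E) `^ 1^-1)%E).
  exact: poweR_ge0.
by apply: ereal_sup_ubound; exists 1 => /=.
Qed.

Section cmo.
Local Set Implicit Arguments.
Local Unset Strict Implicit.
Context (R : realType) (n : nat).
Local Notation E := (euclid R n).
Local Notation mu := (@lebesgue_rV R n).
Context (b : E -> R) (N : R).
Context (vol_gt0 : forall rho : R, 0 < rho -> 0 < vol n rho).
Context (mb : measurable_fun [set: E] b) (CMO_N : CMO_norm b = N%:E).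

(** Unfolds the two suprema and the p-th root into the form in which [negligible_moments] takes its
    moment bounds. *)
Let CMO_le (rho p : R) : 0 < rho -> 1 <= p ->
  (\int[mu]_(x in cball rho) (`|b x - ball_avg b rho| `^ p)%:E <=
   (vol n rho * N `^ p)%:E)%E.
Proof.
move=> rho0 p1; have p0 : 0 < p by exact: lt_le_trans p1.
set I := (\int[mu]_(x in _) _)%E.
have I0 : (0 <= I)%E by apply: integral_ge0 => x _; rewrite lee_fin powR_ge0.
have v0 := vol_gt0 rho0.
have : (((vol n rho)^-1%:E * I) `^ p^-1 <= N%:E)%E.
  rewrite -CMO_N; apply: (@le_trans _ _ (CMOp_norm p b)).
    by apply: ereal_sup_ubound; exists rho.
  by apply: ereal_sup_ubound; exists p.
set J := (_ * I)%E => JN.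
have J0 : (0 <= J)%E by rewrite mule_ge0// lee_fin invr_ge0 ltW.
have N0 : 0 <= N by rewrite -lee_fin (le_trans _ JN)// poweR_ge0.
have : (J <= (N `^ p)%:E)%E.
  have -> : (J = (J `^ p^-1) `^ p)%E by rewrite -poweRrM mulVf ?gt_eqF// poweRe1.
  rewrite -poweR_EFin; apply: gt0_ler_poweR JN; rewrite ?(ltW p0)//.
    by rewrite in_itv/= leey andbT poweR_ge0.
  by rewrite in_itv/= leey andbT lee_fin.
by rewrite /J lee_pdivrMl// EFinM.
Qed.

Let N_ge0 : 0 <= N. Proof. by rewrite -lee_fin -CMO_N CMO_norm_ge0. Qed.

Let deviation_null (rho a : R) : 0 < rho -> N < a ->
  mu.-negligible [set x : E | (enorm x < rho) && (a <= `|b x - ball_avg b rho|)].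
Proof.
move=> rho0 Na.
have := @negligible_moments _ _ _ mu (cball rho) (fun x => `|b x - ball_avg b rho|)
  (vol n rho) N a (@measurable_cball R n rho).
rewrite -ge0_fin_numE// cball_fin_num => /(_ isT).
move=> /(_ _ (fun x => normr_ge0 _) N_ge0 Na (fun p => @CMO_le rho p rho0)).
have mg : measurable_fun [set: E] (fun x => `|b x - ball_avg b rho|).
  apply: (measurableT_comp (@normr_measurable R setT)).
  by apply: measurable_funB => //; exact: measurable_cst.
move=> /(_ mg); apply: negligibleS => x /= /andP[xr ax]; split => //.
Qed.

(** A single null set serves all x and y: the union over balls of radius k + 1 and levels N + 1/(j +
    1). Outside it both values lie within N of the average over one ball containing x and y. *)
Lemma CMO_oscillation :
  exists2 Z : set E, mu.-negligible Z &
    forall x y, ~ Z x -> ~ Z y -> `|b x - b y| <= 2 * N.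
Proof.
exists (\bigcup_k \bigcup_j [set x : E | (enorm x < k.+1%:R) &&
    (N + j.+1%:R^-1 <= `|b x - ball_avg b k.+1%:R|)]).
  apply: negligible_bigcup => k; apply: negligible_bigcup => j.
  by apply: deviation_null => //; rewrite ltrDl invr_gt0.
move=> x y Zx Zy.
pose k := Num.bound (enorm x + enorm y).
have xyk : enorm x + enorm y < k.+1%:R.
  rewrite (lt_le_trans (archi_boundP _))//; first by rewrite addr_ge0 ?enorm_ge0.
  by rewrite ler_nat.
have key z : ~ (\bigcup_k \bigcup_j [set x : E | (enorm x < k.+1%:R) &&
    (N + j.+1%:R^-1 <= `|b x - ball_avg b k.+1%:R|)]) z -> enorm z < k.+1%:R ->
    `|b z - ball_avg b k.+1%:R| <= N.
  move=> Zz zk; rewrite leNgt; apply/negP => /ltr_add_invr[j Nj]; apply: Zz.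
  by exists k => //; exists j => //=; rewrite zk ltW.
have bx : `|b x - ball_avg b k.+1%:R| <= N.
  by apply: key => //; apply: le_lt_trans xyk; rewrite lerDl enorm_ge0.
have by' : `|b y - ball_avg b k.+1%:R| <= N.
  by apply: key => //; apply: le_lt_trans xyk; rewrite lerDr enorm_ge0.
rewrite (_ : b x - b y = (b x - ball_avg b k.+1%:R) - (b y - ball_avg b k.+1%:R)).
  by rewrite (le_trans (ler_normB _ _))// mulr_natl mulr2n lerD.
by ring.
Qed.
End cmo.

(** * Mixed means *)

Lemma integral_bool d (T : measurableType d) (R : realType)
    (mu : {measure set T -> \bar R}) (P : T -> bool) (F : T -> \bar R) :
  (\int[mu]_(x in [set x | P x]) F x = \int[mu]_x (if P x then F x else 0))%E.
Proof.
rewrite integral_mkcond; apply: eq_integral => x _; rewrite patchE.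
by case: ifPn => [/set_mem/= ->//|/negP xP]; case: ifPn => // Px; case: xP; rewrite inE.
Qed.

Lemma powR_invB1 (R : realType) (t a : R) : 0 < t ->
  t^-1 `^ (a - 1) * t^-1 = (t `^ a)^-1.
Proof.
move=> t0; rewrite -powR_inv1 ?(ltW t0)// -powRrM -powRD; last first.
  by rewrite (gt_eqF t0) implybT.
by rewrite -powRN; congr (_ `^ _); ring.
Qed.

Section mixed_means.
Context d (T : measurableType d) (R : realType).
Context (mu : {sigma_finite_measure set T -> \bar R}) (V : T -> R).
Context (mV : measurable_fun [set: T] V) (V0 : forall x, 0 <= V x).
Context (dilV : forall (c : R) (G : R -> \bar R), 0 < c ->
  measurable_fun [set: R] G -> (forall t, 0 <= G t)%E ->
  (\int[mu]_x G (c * V x)%R = c^-1%:E * \int[mu]_x G (V x))%E).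
Context (unitV : mu [set x | 0 < V x < 1] = 1%E).
Context (V0_negligible : mu.-negligible [set x | V x <= 0]).

(** Common form of [M] and [Mstar], with the radius replaced by the volume [t] of its ball. *)
Definition radial_mean (P : T -> bool) (q : R) (g : T -> \bar R) (beta t : R) : \bar R :=
  (((t `^ beta)^-1%:E *
   \int[mu]_(x in [set x | P x]) ((V x `^ (beta - 1))%:E * `|g x| `^ q)) `^ q^-1)%E.

(** [D^~ y] is the domain of the inner mean at y and [D0] that of the outer mean. Both are given by
    the condition [U] on quotients of volumes, except possibly where V vanishes: the origin lies in
    every ball while [U 0] is false. *)
Context (U : R -> bool) (D : T -> T -> bool) (D0 : T -> bool) (t0 : R).
Context (mU : measurable_fun [set: R] U) (U0 : U 0 = false).
Context (mD : measurable_fun [set: T * T] (fun z => D z.2 z.1)).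
Context (mD0 : measurable_fun [set: T] D0) (t0_gt0 : 0 < t0).
Context (DU : forall x y, 0 < V x -> 0 < V y -> D x y = U (V x / V y)).
Context (D0U : forall y, 0 < V y -> D0 y = U (V y / t0)).

Context (r s alpha gamma K : R) (b f : T -> R) (Z : set T).
Context (r_gt0 : 0 < r) (r_lt_s : r < s) (K_ge0 : 0 <= K).
Context (U_alpha : forall u, U u -> u `^ (alpha - 1) <= 1).
Context (mb : measurable_fun [set: T] b) (mf : measurable_fun [set: T] f).
Context (Z_negligible : mu.-negligible Z).
Context (b_osc : forall x y, ~ Z x -> ~ Z y -> `|b x - b y| <= K).

(** The data for [mult_minkowski]: [k] is the domain of the inner mean, and [w] combines domain,
    weight and normalisation of the outer mean. *)
Let p := s / r.
Let phi x := `|f x| `^ r.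
Let k t : R := if U t then 1 else 0.
Let w t : R := if U (t / t0) then (t0 `^ gamma)^-1 * t `^ (gamma - 1) else 0.

Let s_gt0 : 0 < s. Proof. exact: lt_trans r_lt_s. Qed.
Let p_gt1 : 1 < p. Proof. by rewrite /p ltr_pdivlMr// mul1r. Qed.
Let mphi : measurable_fun [set: T] phi. Proof. by rewrite /phi; meas. Qed.
Let mk : measurable_fun [set: R] k. Proof. by rewrite /k; meas. Qed.
Let mw : measurable_fun [set: R] w. Proof. by rewrite /w; meas. Qed.
Let phi_ge0 x : 0 <= phi x. Proof. exact: powR_ge0. Qed.
Let k_ge0 t : 0 <= k t. Proof. by rewrite /k; case: ifP. Qed.
Let w_ge0 t : 0 <= w t.
Proof. by rewrite /w; case: ifP => // _; rewrite mulr_ge0 ?invr_ge0 ?powR_ge0. Qed.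
Let w0 : w 0 = 0. Proof. by rewrite /w mul0r U0. Qed.
Let k0 : k 0 = 0. Proof. by rewrite /k U0. Qed.

Let A y := mconv mu V phi k (V y).

Let mA : measurable_fun [set: T] A.
Proof.
have := measurable_mconv mu mV mphi mk phi_ge0 k_ge0.
by move=> m; apply: (measurableT_comp m).
Qed.

Let A_ge0 y : (0 <= A y)%E. Proof. exact: mconv_ge0. Qed.

Let g1 y x := if D x y then V x `^ (alpha - 1) * (`|b x - b y| * `|f x|) `^ r else 0.

Let mg1 : measurable_fun [set: T * T] (fun z => g1 z.1 z.2).
Proof. by rewrite /g1; meas. Qed.

Let g1_ge0 y x : 0 <= g1 y x.
Proof. by rewrite /g1; case: ifP => // _; rewrite mulr_ge0 ?powR_ge0. Qed.

(** The r-th power of the commutator mean at y. *)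
Let inner y : \bar R := ((V y `^ alpha)^-1%:E * \int[mu]_x (g1 y x)%:E)%E.

Let innerE y : (radial_mean (D^~ y) r (fun x => (`|b x - b y| * `|f x|)%:E) alpha (V y) =
  inner y `^ r^-1)%E.
Proof.
rewrite /radial_mean integral_bool; congr ((_ * _) `^ _)%E.
apply: eq_integral => x _; rewrite /g1; case: ifP => // _.
by rewrite abse_EFin ger0_norm ?mulr_ge0// poweR_EFin EFinM.
Qed.

Let inner_ge0 y : (0 <= inner y)%E.
Proof.
rewrite mule_ge0 ?lee_fin ?invr_ge0 ?powR_ge0//.
by apply: integral_ge0 => x _; rewrite lee_fin.
Qed.

Let minner : measurable_fun [set: T] inner.
Proof.
apply: emeasurable_funM; first by meas.
apply: (@measurable_fun_fubini_tonelli_F _ _ _ _ _ mu (fun z : T * T => (g1 z.1 z.2)%:E)).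
  by meas.
by move=> z; rewrite lee_fin.
Qed.

(** For almost every x the oscillation of b is at most [K], and the weight is (V x / V y)^(alpha -
    1) (V y)^-1, whose first factor is at most 1 on the domain by [U_alpha]. *)
Let inner_le y : ~ Z y -> 0 < V y -> (inner y <= (K `^ r)%:E * A y)%E.
Proof.
move=> Zy Vy; rewrite /inner -integralZE//; last 2 first.
- by rewrite invr_ge0 powR_ge0.
- exact: (measurable_fun_pair2 y mg1).
rewrite /A /mconv -integralZE//; last 3 first.
- exact: powR_ge0.
- by meas.
- by move=> x; rewrite !mulr_ge0// invr_ge0.
apply: ae_ge0_le_integral => //.
- by move=> x _; rewrite lee_fin mulr_ge0 ?invr_ge0 ?powR_ge0.
- apply/measurable_EFinP; apply: measurable_funM => //.
  exact: (measurable_fun_pair2 y mg1).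
- by move=> x _; rewrite lee_fin !mulr_ge0 ?invr_ge0 ?powR_ge0.
- by meas.
apply: (negligibleS _ (negligibleU Z_negligible V0_negligible)) => x /= /not_implyP[_].
apply: contra_notP => /not_orP[Zx /negP]; rewrite -ltNge => Vx.
rewrite lee_fin ger0_norm// /g1 (DU _ _ Vx Vy) /k.
case: ifPn => [Uxy|_]; last by rewrite !mulr0.
rewrite mulr1 powRM// -/(phi x).
have -> : (V y `^ alpha)^-1 * (V x `^ (alpha - 1) * (`|b x - b y| `^ r * phi x)) =
    (V x / V y) `^ (alpha - 1) * ((V y)^-1 * (`|b x - b y| `^ r * phi x)).
  rewrite powRM ?invr_ge0// -(powR_invB1 _ _ alpha Vy); ring.
apply: (@le_trans _ _ (1 * ((V y)^-1 * (`|b x - b y| `^ r * phi x)))).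
  by apply: ler_wpM2r; rewrite ?mulr_ge0 ?invr_ge0 ?powR_ge0// U_alpha.
rewrite mul1r mulrCA; apply: ler_wpM2r; first by rewrite mulr_ge0 ?invr_ge0.
apply: ge0_ler_powR; rewrite ?nnegrE ?(ltW r_gt0)//.
exact: b_osc.
Qed.

Let Y : \bar R := (\int[mu]_y ((w (V y))%:E * A y `^ p))%E.

Let mouter : measurable_fun [set: T]
  (fun y => if D0 y then ((V y `^ (gamma - 1))%:E * `|inner y `^ r^-1| `^ s)%E else 0%E).
Proof.
apply: measurable_fun_ifT => //; apply: emeasurable_funM; first by meas.
apply: (measurableT_comp (measurable_poweR s)).
apply: measurableT_comp => //.
exact: (measurableT_comp (measurable_poweR r^-1)).
Qed.

Let commutator_le_Y :
  (radial_mean D0 s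
    (fun y => radial_mean (D^~ y) r (fun x => (`|b x - b y| * `|f x|)%:E) alpha (V y))
    gamma t0 <= K%:E * (Y `^ p^-1) `^ r^-1)%E.
Proof.
have Y0 : (0 <= Y)%E.
  by apply: integral_ge0 => y _; rewrite mule_ge0 ?lee_fin ?poweR_ge0.
(* Since p r = s, both sides become s-th roots and the integrals can be compared almost
   everywhere. *)
have -> : (K%:E * (Y `^ p^-1) `^ r^-1 = ((K `^ s)%:E * Y) `^ s^-1)%E.
  rewrite poweRM ?lee_fin ?powR_ge0// poweR_EFin -powRrM divff ?gt_eqF// powRr1//.
  by rewrite -poweRrM /p invf_div mulrAC divff ?gt_eqF// mul1r.
rewrite {1}/radial_mean; under eq_integral do rewrite innerE.
rewrite integral_bool.
set J := (\int[mu]_y _)%E.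
have J0 : (0 <= J)%E.
  apply: integral_ge0 => y _; case: ifP => // _.
  by rewrite mule_ge0 ?lee_fin ?powR_ge0 ?poweR_ge0.
have tg0 : 0 <= (t0 `^ gamma)^-1 by rewrite invr_ge0 powR_ge0.
apply: gt0_ler_poweR.
- by rewrite invr_ge0 ltW.
- by rewrite in_itv/= leey andbT mule_ge0.
- by rewrite in_itv/= leey andbT mule_ge0// lee_fin powR_ge0.
rewrite /J -ge0_integralZl//; last first.
  move=> y _; case: ifP => // _.
  by rewrite mule_ge0 ?lee_fin ?powR_ge0 ?poweR_ge0.
have mY : measurable_fun [set: T] (fun y => ((w (V y))%:E * A y `^ p)%E) by meas.
rewrite /Y -ge0_integralZl//; last 2 first.
- by move=> y _; rewrite mule_ge0 ?lee_fin ?poweR_ge0.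
- by rewrite lee_fin powR_ge0.
apply: ae_ge0_le_integral => //.
- move=> y _; rewrite mule_ge0//; case: ifP => // _.
  by rewrite mule_ge0 ?lee_fin ?powR_ge0 ?poweR_ge0.
- by apply: emeasurable_funM => //; exact: measurable_cst.
- by move=> y _; rewrite !mule_ge0 ?lee_fin ?powR_ge0 ?poweR_ge0.
- by apply: emeasurable_funM => //; exact: measurable_cst.
apply: (negligibleS _ (negligibleU Z_negligible V0_negligible)) => y /= /not_implyP[_].
apply: contra_notP => /not_orP[Zy /negP]; rewrite -ltNge => Vy.
rewrite (D0U _ Vy) /w; case: ifPn => [Uy|_]; last by rewrite !(mul0e, mule0).
rewrite gee0_abs ?poweR_ge0// -poweRrM.
have -> : r^-1 * s = p by rewrite mulrC.
rewrite EFinM -!muleA [leRHS]muleCA; apply: lee_wpmul2l; first by rewrite lee_fin.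
rewrite [leRHS]muleCA; apply: lee_wpmul2l; first by rewrite lee_fin powR_ge0.
have -> : ((K `^ s)%:E * A y `^ p = ((K `^ r)%:E * A y) `^ p)%E.
  rewrite poweRM ?lee_fin ?powR_ge0// poweR_EFin -powRrM.
  by rewrite /p mulrCA divff ?gt_eqF// mulr1.
apply: gt0_ler_poweR.
- by rewrite ltW// (lt_trans _ p_gt1).
- by rewrite in_itv/= leey andbT.
- by rewrite in_itv/= leey andbT mule_ge0// lee_fin powR_ge0.
exact: inner_le.
Qed.

Let h t x := if U (V x / t) then V x `^ (gamma - 1) * `|f x| `^ s else 0.

Let h_ge0 t x : 0 <= h t x.
Proof. by rewrite /h; case: ifP => // _; rewrite mulr_ge0 ?powR_ge0. Qed.

(** The r-th power of the s-th mean of f at volume t, as r / s = 1 / p; its domain is expressed by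
    [U], so that it depends on t alone. *)
Let G (t : R) : \bar R :=
  (((t `^ gamma)^-1%:E * \int[mu]_x (h t x)%:E) `^ p^-1)%E.

Let mG : measurable_fun [set: R] G.
Proof.
apply: (measurableT_comp (measurable_poweR p^-1)).
apply: emeasurable_funM; first by meas.
apply: (@measurable_fun_fubini_tonelli_F _ _ _ _ _ mu (fun z : R * T => (h z.1 z.2)%:E)).
  by rewrite /h; meas.
by move=> z; rewrite lee_fin.
Qed.

Let G_ge0 t : (0 <= G t)%E. Proof. exact: poweR_ge0. Qed.

(** Dilating the outer weight by u turns it into the weight of an inner mean at volume t0 u: the
    domains match because (V x / u) / t0 = V x / (t0 u). *)
Let mconv_wE u : 0 < u ->
  (mconv mu V (fun x => (phi x `^ p)%R) w u `^ p^-1 = G (t0 * u))%E.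
Proof.
move=> u0; rewrite /mconv /G -integralZE//; last 2 first.
- by rewrite invr_ge0 powR_ge0.
- by rewrite /h; meas.
congr (_ `^ _)%E; apply: eq_integral => x _; congr EFin.
rewrite gtr0_norm// /h /w -mulrA -invfM (mulrC u t0).
case: ifP => _; last by rewrite !mulr0.
have -> : phi x `^ p = `|f x| `^ s.
  by rewrite /phi -powRrM /p mulrC divfK// gt_eqF.
rewrite powRM ?invr_ge0 ?(ltW u0)// powRM ?(ltW u0) ?(ltW t0_gt0)// invfM.
rewrite -(powR_invB1 _ _ gamma u0); ring.
Qed.

(** After Minkowski, the substitution t0 V z -> V y produces the factor t0^-1, the normalisation of
    the outer mean with exponent 1. Points with V x = 0 may belong to [D] but not to [U], hence an
    inequality. *)
Let Y_le_mean : (Y `^ p^-1 <=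
  t0^-1%:E * \int[mu]_y (if D0 y then `|((V y `^ gamma)^-1%:E *
    \int[mu]_x (if D x y then V x `^ (gamma - 1) * `|f x| `^ s else 0)%:E) `^ s^-1| `^ r
    else 0))%E.
Proof.
apply: (le_trans (mult_minkowski mV V0 dilV unitV
  p_gt1 mphi mw mk phi_ge0 w_ge0 k_ge0 w0 k0)).
pose H t : \bar R := ((k (t / t0))%:E * G t)%E.
have mH : measurable_fun [set: R] H by rewrite /H; meas.
have H0 t : (0 <= H t)%E by rewrite mule_ge0 ?lee_fin.
have -> : (\int[mu]_z ((k (V z))%:E * mconv mu V (fun x => (phi x `^ p)%R) w (V z) `^ p^-1)
    = \int[mu]_z H (t0 * V z)%R)%E.
  apply: eq_integral => z _; rewrite /H.
  have -> : t0 * V z / t0 = V z by rewrite mulrC mulKf// gt_eqF.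
  have [->|z0] := eqVneq (V z) 0; first by rewrite k0 !mul0e.
  by rewrite mconv_wE// lt_def z0 V0.
rewrite dilV//; apply: lee_wpmul2l; first by rewrite lee_fin invr_ge0 ltW.
apply: ge0_le_integral => //.
- by apply: (measurableT_comp mH).
- apply: measurable_fun_ifT => //.
  apply: (measurableT_comp (measurable_poweR r)); apply: measurableT_comp => //.
  apply: (measurableT_comp (measurable_poweR s^-1)).
  apply: emeasurable_funM; first by meas.
  apply: (@measurable_fun_fubini_tonelli_F _ _ _ _ _ mu (fun z : T * T =>
    (if D z.2 z.1 then V z.2 `^ (gamma - 1) * `|f z.2| `^ s else 0)%:E)).
    by meas.
  by move=> z; rewrite lee_fin; case: ifP => // _; rewrite mulr_ge0 ?powR_ge0.
move=> y _; rewrite /H /k; case: ifPn => [Uy|_]; last first.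
  by rewrite mul0e; case: ifP => // _; rewrite poweR_ge0.
have V_neq0 x : U (V x / V y) -> V x != 0.
  by apply: contraTneq => ->; rewrite mul0r U0.
have Vy : 0 < V y.
  by rewrite lt_def V0 andbT; apply: contraTneq Uy => ->; rewrite mul0r U0.
rewrite D0U// Uy mul1e gee0_abs ?poweR_ge0// -poweRrM /G.
have -> : s^-1 * r = p^-1 by rewrite /p invf_div mulrC.
have I0 (F : T -> R) : (forall x, 0 <= F x) ->
    (0 <= (V y `^ gamma)^-1%:E * \int[mu]_x (F x)%:E)%E.
  move=> F0; rewrite mule_ge0 ?lee_fin ?invr_ge0 ?powR_ge0//.
  by apply: integral_ge0 => x _; rewrite lee_fin.
have F0 x : 0 <= if D x y then V x `^ (gamma - 1) * `|f x| `^ s else 0.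
  by case: ifP => // _; rewrite mulr_ge0 ?powR_ge0.
apply: gt0_ler_poweR.
- by rewrite invr_ge0 ltW// (lt_trans _ p_gt1).
- by rewrite in_itv/= leey andbT I0.
- by rewrite in_itv/= leey andbT I0.
apply: lee_wpmul2l; first by rewrite lee_fin invr_ge0 powR_ge0.
have mDy : measurable_fun [set: T] (D^~ y) by exact: (measurable_fun_pair2 y mD).
apply: ge0_le_integral => //.
- by move=> x _; rewrite lee_fin.
- by rewrite /h; meas.
- by meas.
move=> x _; rewrite lee_fin /h; case: ifPn => [Uxy|_]; last exact: F0.
by rewrite DU ?Uxy// lt_def V0 V_neq0.
Qed.

Lemma radial_mean_commutator_le :
  (radial_mean D0 s
    (fun y => radial_mean (D^~ y) r (fun x => (`|b x - b y| * `|f x|)%:E) alpha (V y))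
    gamma t0 <=
   K%:E * radial_mean D0 r
    (fun y => radial_mean (D^~ y) s (EFin \o f) gamma (V y)) 1 t0)%E.
Proof.
apply: (le_trans commutator_le_Y); apply: lee_wpmul2l; first by rewrite lee_fin.
rewrite [leRHS]/radial_mean; apply: gt0_ler_poweR.
- by rewrite invr_ge0 ltW.
- by rewrite in_itv/= leey andbT poweR_ge0.
- rewrite in_itv/= leey andbT mule_ge0 ?lee_fin ?invr_ge0 ?powR_ge0//.
  by apply: integral_ge0 => y _; rewrite mule_ge0 ?lee_fin ?powR_ge0 ?poweR_ge0.
apply: (le_trans Y_le_mean); rewrite powRr1 ?(ltW t0_gt0)// integral_bool.
rewrite le_eqVlt; apply/orP; left; apply/eqP; congr (_ * _)%E.
apply: eq_integral => y _; case: ifP => // _.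
(* The outer weight has exponent 1 - 1 = 0, and is 1 even where V y = 0. *)
rewrite subrr powRr0 mul1e /radial_mean integral_bool.
congr (`| (_ * _) `^ _ | `^ _)%E; apply: eq_integral => x _.
by case: ifP.
Qed.

End mixed_means.

Arguments radial_mean {d T R} mu V P q g beta t.

(** * Application to balls in R^n *)

Section assembly.
Local Set Implicit Arguments.
Local Unset Strict Implicit.
Context (R : realType) (n : nat).
Local Notation E := (euclid R n).
Local Notation mu := (@lebesgue_rV R n : {sigma_finite_measure set E -> \bar R}).
Local Notation V := (fun x : E => vol n (enorm x)).

Lemma Mstar_radial_mean (q : R) (g : E -> \bar R) (beta rho : R) :
  Mstar q g beta rho =
  radial_mean mu V (fun x : E => rho <= enorm x) q g beta (vol n rho).
Proof.
rewrite /Mstar (_ : ~` cball rho = [set x : E | rho <= enorm x])//.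
by apply/seteqP; split => x /=; rewrite /cball/= leNgt => /negP.
Qed.

(** The degenerate case: if the unit ball is null, so is the whole space. Every set, hence every
    function, is then measurable by completeness, and all integrals are 0. *)
Lemma wmean_null (D : set E) (q : R) (g : E -> \bar R) (beta rho : R) :
  (0 < n)%N -> vol n 1 = 0 :> R -> 0 < q -> wmean D q g beta rho = 0%E.
Proof.
move=> n0 vol10 q0; rewrite /wmean.
have ball0 : @lebesgue_rV R n (cball 1) = 0%E.
  by rewrite -(fineK (@cball_fin_num R n 1)) -[fine _]/(vol n 1) vol10.
have T0 : mu.-negligible [set: E].
  rewrite -(@cball_bigcup R n); apply: negligible_bigcup => k.
  exists (cball k%:R); split => //; first exact: measurable_cball.
  have [->|k0] := posnP k; first by rewrite cball_le0// measure0.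
  have {}k0 : 0 < k%:R :> R by rewrite ltr0n.
  by rewrite [LHS](@lebesgue_rV_cball R n _ k0) ball0 mule0.
have null (A : set E) : lebesgue_outer A = 0%E.
  have [B [_ B0 TB]] := T0; apply/eqP; rewrite eq_le lebesgue_outer_ge0 andbT -B0.
  by apply: le_lebesgue_outer => x _; exact: TB.
have mE (A : set E) : measurable A.
  by apply: le_caratheodory_measurable => X; rewrite /= !null adde0.
rewrite (_ : (\int[_]_(x in D) _)%E = 0%E).
  by rewrite mule0 poweR0r// invr_eq0 gt_eqF.
apply: null_set_integral; [exact: mE| |exact: null].
by move=> _ A _; exact: mE.
Qed.

Context (n_gt0 : (0 < n)%N).
Context (vol1_gt0 : 0 < vol n 1 :> R).

Lemma vol_gt0 (rho : R) : 0 < rho -> 0 < vol n rho.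
Proof. by move=> rho0; rewrite (volE n rho0) mulr_gt0 ?exprn_gt0. Qed.

Let V_gt0 (x : E) : 0 < V x -> 0 < enorm x.
Proof.
have := enorm_ge0 x; rewrite le_eqVlt => /predU1P[<-|//].
by rewrite vol0// ltxx.
Qed.

Let V_negligible : mu.-negligible [set x : E | V x <= 0].
Proof.
exists [set x : E | enorm x <= 0]; split.
- exact: measurable_enorm_le0.
- exact: lebesgue_rV_enorm0.
by move=> x /=; rewrite !leNgt; apply: contra => /vol_gt0.
Qed.

Context (r s rad alpha gamma : R) (b f : E -> R).
Context (r_gt0 : 0 < r).
Context (r_lt_s : r < s).
Context (rad_gt0 : 0 < rad).
Context (bCMO : CMO b).
Context (f_meas : measurable_fun [set: E] f).

(** Treats both cases at once: [d] compares radii and [U] expresses the same comparison by the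
    quotient of volumes. The bound holds with 2 ||b||_CMO, and [c1_ge2] absorbs the 2. *)
Lemma commutator_mean_le (U : R -> bool) (d : R -> R -> bool) :
  measurable_fun [set: R] U -> U 0 = false ->
  measurable_fun [set: R * R] (fun z => d z.1 z.2) ->
  (forall u v, 0 < u -> 0 < v -> d u v = U (vol n u / vol n v)) ->
  (forall u, U u -> u `^ (alpha - 1) <= 1) ->
  (radial_mean mu V (fun y => d (enorm y) rad) s (fun y =>
     radial_mean mu V (fun x => d (enorm x) (enorm y)) r
       (fun x => (`|b x - b y| * `|f x|)%:E) alpha (vol n (enorm y)))
     gamma (vol n rad) <=
   c1 n r alpha * CMO_norm b * radial_mean mu V (fun y => d (enorm y) rad) r (fun y =>
     radial_mean mu V (fun x => d (enorm x) (enorm y)) s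
       (EFin \o f) gamma (vol n (enorm y))) 1 (vol n rad))%E.
Proof.
move=> mU U0 md dU U_alpha.
have [[mb _] Noo] := bCMO.
have CMO0 := CMO_norm_ge0 R n b.
have CMON : CMO_norm b = (fine (CMO_norm b))%:E by rewrite fineK// ge0_fin_numE.
have N0 : 0 <= fine (CMO_norm b) by rewrite fine_ge0.
have [Z Z0 bZ] := CMO_oscillation vol_gt0 mb CMON.
have md0 c : measurable_fun [set: R] (fun t => d t c).
  exact: (measurable_fun_pair1 c md).
have mE2 : measurable_fun [set: E * E] (fun z : E * E => (enorm z.2, enorm z.1)).
  apply: measurable_fun_pair.
    exact: (measurableT_comp (@measurable_enorm R n) measurable_snd).
  exact: (measurableT_comp (@measurable_enorm R n) measurable_fst).
have := @radial_mean_commutator_le _ _ _ mu V (measurable_vol_enorm n_gt0)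
  (fun x => vol_ge0 n _) (vol_dilation n_gt0) (vol_normalised n_gt0 vol1_gt0)
  V_negligible U (fun x y => d (enorm x) (enorm y)) (fun y => d (enorm y) rad)
  (vol n rad) mU U0.
move=> /(_ (measurableT_comp md mE2) (measurableT_comp (md0 rad) (@measurable_enorm R n))
  (vol_gt0 rad_gt0)).
move=> /(_ (fun x y Vx Vy => dU _ _ (V_gt0 Vx) (V_gt0 Vy))
  (fun y Vy => dU _ _ (V_gt0 Vy) rad_gt0)).
move=> /(_ r s alpha gamma (2 * fine (CMO_norm b)) b f Z r_gt0 r_lt_s).
move=> /(_ ltac:(by rewrite mulr_ge0) U_alpha mb f_meas Z0 bZ) /le_trans; apply.
apply: lee_wpmul2r; first exact: poweR_ge0.
rewrite EFinM -CMON; apply: lee_wpmul2r => //.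
exact: c1_ge2.
Qed.

End assembly.

Theorem theorem3 (R : realType) (n : nat) (r s rad alpha gamma : R)
    (b f : euclid R n -> R)
    (n_ge1 : (1 <= n)%N) (r_gt0 : 0 < r) (r_lt_s : r < s) (rad_gt0 : 0 < rad)
    (bCMO : CMO b)
    (f_meas : measurable_fun [set: euclid R n] f)
    (f_bdd : locally_bounded f)
    (f_Lr : weighted_Lloc r (n%:R * (alpha - 1)) f) :
  (1 < alpha ->
    (M s (Mcomm r b f alpha) gamma rad <=
     c1 n r alpha * CMO_norm b *
       M r (fun y : euclid R n => M s (EFin \o f) gamma (enorm y)) 1 rad)%E) /\
  (alpha < 1 ->
    (Mstar s (Mstar_comm r b f alpha) gamma rad <=
     c1 n r alpha * CMO_norm b *
       Mstar r (fun y : euclid R n => Mstar s (EFin \o f) gamma (enorm y)) 1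
         rad)%E).
Proof.
have CMO0 := CMO_norm_ge0 R n b.
have c1_ge0 : (0 <= c1 n r alpha)%E by exact: poweR_ge0.
have [vol10|vol1_gt0] := predU1P (eqbLR (le_eqVlt _ _) (@vol_ge0 R n 1)).
  have s_gt0 : 0 < s by exact: lt_trans r_lt_s.
  split=> _; rewrite /M /Mstar wmean_null// !mule_ge0//; exact: poweR_ge0.
split=> alpha1.
(* The value 0 is excluded from the quotient condition to satisfy [U 0 = false]. On ]0,1[ the power
   of exponent alpha - 1 > 0 is at most 1. *)
- apply: (@commutator_mean_le R n n_ge1 vol1_gt0 r s rad alpha gamma b f r_gt0
    r_lt_s rad_gt0 bCMO f_meas (fun t => (0 < t) && (t < 1)) (fun u v => u < v)).
  + by meas.
  + by rewrite ltxx.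
  + by meas.
  + move=> u v u0 v0; have := vol_gt0 vol1_gt0; move=> vol_gt0.
    by rewrite divr_gt0 ?vol_gt0// ltr_pdivrMr ?vol_gt0// mul1r ltr_vol// ltW.
  + move=> u /andP[u0 u1]; apply: (@le_trans _ _ (1 `^ (alpha - 1))); last by rewrite powR1.
    by apply: ge0_ler_powR; rewrite ?nnegrE ?subr_ge0 ?ltW.
- rewrite !Mstar_radial_mean.
  rewrite (funext (fun y => Mstar_radial_mean r
    (fun x => (`|b x - b y| * `|f x|)%:E) alpha (enorm y)) : Mstar_comm r b f alpha = _).
  rewrite (funext (fun y : euclid R n =>
    Mstar_radial_mean s (EFin \o f) gamma (enorm y))).
  (* Outside the ball the quotient of volumes is at least 1, where the power of exponent alpha - 1 <
     0 is at most 1. *)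
  apply: (@commutator_mean_le R n n_ge1 vol1_gt0 r s rad alpha gamma b f r_gt0
    r_lt_s rad_gt0 bCMO f_meas (fun t => 1 <= t) (fun u v => v <= u)).
  + by meas.
  + by rewrite ler10.
  + by meas.
  + move=> u v u0 v0; have := vol_gt0 vol1_gt0; move=> vol_gt0.
    by rewrite ler_pdivlMr ?vol_gt0// mul1r !leNgt ltr_vol// ltW.
  + move=> u u1; apply: (@le_trans _ _ (u `^ 0)); last by rewrite powRr0.
    by apply: ler_powR => //; rewrite subr_le0 ltW.
Qed.
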